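(* (1) If $u\ne 1$ and $0<u<\sqrt3$, then $\dim_H\widetilde P^u<1$. (2) If $0<u<1$, then $\dim_H\widetilde P^u\le s(x_u)/\log 2$. Moreover, $\widetilde P^u(K)=0$ for any Borel set $K\subset[0,1]$ with $\dim_H(K)<s\!\left(\frac{2x_u}{1+x_u}\right)/\log 2$.
   Context: Let $x_u=\frac{2}{1+\sqrt{1+8u^2}}$ for $u\ge0$, and $s(p)=-p\log p-(1-p)\log(1-p)$ for $p\in[0,1]$. $\dim_H(K)$ denotes the Hausdorff dimension of $K\subset[0,1]$; for a probability measure $\mu$ on $[0,1]$, $\dim_H\mu=\inf\{\dim_H(K):K\in\mathcal B([0,1]),\ \mu(K)=1\}$. Paths. For $n\ge 0$ let $W(n)$ be the set of $(\omega(0),\dots,\omega(n))\in\mathbb Z^{n+1}$ with $\omega(0)=0$ and $|\omega(i)-\omega(i+1)|=1$ for $0\le i\le n-1$; let $W^*=\bigcup_{n\ge 0}W(n)$ and $L(\omega)=n$ for $\omega\in W(n)$. For $\omega\in W^*$ and integers $M\ge 0$, let $T_0^M(\omega)=0$ and, for $i\ge 1$, $T_i^M(\omega)=\min\{j>T_{i-1}^M(\omega):\omega(j)\in 2^M\mathbb Z\setminus\{\omega(T_{i-1}^M(\omega))\}\}$, with value $+\infty$ if the minimum does not exist. Let $(2^{-M}Q_M\omega)(i)=2^{-M}\omega(T_i^M(\omega))$ for all $i$ with $T_i^M(\omega)<\infty$; this is an element of $W^*$. Let $W_{N,\pm}=\{\omega\in W^*: L(\omega)=T_1^N(\omega),\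 \omega(T_1^N(\omega))=\pm 2^N\}$. Measures. For $\omega\in W_{1,+}$ let $P^u_{1,+}(\{\omega\})=u^{L(\omega)-2}x_u^{L(\omega)-1}$ (with $0^0=1$, and $0^n=0$ for $n\geq 1$). Inductively, for $N\ge1$ and $\omega\in W_{N+1,+}$, let $\omega'=2^{-N}Q_N\omega\in W_{1,+}$ and, for $1\le j\le L(\omega')$, let $\widetilde\omega_j\in W_{N,+}$ be the path obtained from the segment $(\omega(T^N_{j-1}(\omega)+i)-\omega(T^N_{j-1}(\omega)))_{0\le i\le T^N_j(\omega)-T^N_{j-1}(\omega)}$ by multiplying it by the sign of $\omega(T_j^N(\omega))-\omega(T_{j-1}^N(\omega))$; set $P^u_{N+1,+}(\{\omega\})=P^u_{1,+}(\{\omega'\})\prod_{j=1}^{L(\omega')}P^u_{N,+}(\{\widetilde\omega_j\})$. Each $P^u_{N,+}$ is a probability measure on $W_{N,+}$. Let $P^u_{N,-}(\{\omega\})=P^u_{N,+}(\{-\omega\})$ for $\omega\in W_{N,-}$. Let $W_\infty$ be the set of infinite paths $(\omega(0),\omega(1),\dots)$ in $\mathbb Z$ with $\omega(0)=0$ and $|\omega(i)-\omega(i+1)|=1$ for all $i\ge0$, with the $\sigma$-algebra generated by cylinder sets. $P^u$ is the probability measure on $W_\infty$ (known to exist) such that for all $N\ge1$ and $\widetilde\omega\in W_{N,+}$ (resp. $W_{N,-}$), $P^u(\{\omega\in W_\infty:\omega(j)=\widetilde\omega(j),\ 0\le j\le L(\widetilde\omega)\})=\frac12P^u_{N,+}(\{\widetilde\omega\})$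 (resp. $\frac12P^u_{N,-}(\{\widetilde\omega\})$). Range and limit. For $n\ge1$ and $\omega\in W_\infty$, $R_n(\omega)$ is the number of points of $\mathbb Z$ that $\omega$ visits before it hits the set $\{2^n,-2^n\}$. Under $P^u$ the random variables $R_n/2^n-1$ converge weakly as $n\to\infty$; $\widetilde P^u$ denotes the limiting probability measure on $[0,1]$. *)

(* Defs.v *)
From HB Require Import structures.
From mathcomp Require Import all_boot all_order all_algebra finmap.
From mathcomp Require Import all_classical all_reals all_analysis.

Set Implicit Arguments.
Unset Strict Implicit.
Unset Printing Implicit Defensive.

Import Order.TTheory GRing.Theory Num.Theory numFieldNormedType.Exports.

Local Open Scope classical_set_scope.
Local Open Scope ring_scope.

(* A finite path (w(0), ..., w(n)) is the sequence of its n + 1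
   values, so that w(i) is w`_i. *)

Definition Wstar (w : seq int) : bool :=
  if w is x :: s then (x == 0) && path (fun a b : int => `|a - b| == 1) x s
  else false.

Definition plen (w : seq int) : nat := (size w).-1.

(* hitT M w i is T_i^M(w), with None standing for +oo. *)
Fixpoint hitT (M : nat) (w : seq int) (i : nat) : option nat :=
  if i is i'.+1 then
    if hitT M w i' is Some k then
      ohead [seq j <- iota k.+1 (plen w - k)
            | (2 ^+ M %| w`_j)%Z & w`_j != w`_k]
    else None
  else Some 0%N.

(* The path 2^{-M} Q_M w.  The finite T_i^M(w) are those of an initial segment
   of indices, all < size w because i <= T_i^M(w) <= plen w. *)
Definition coarsen (M : nat) (w : seq int) : seq int :=
  pmap (fun i => omap (fun j => (w`_j %/ 2 ^+ M)%Z) (hitT M w i))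
       (iota 0 (size w)).

Definition Wplus (N : nat) (w : seq int) : bool :=
  [&& Wstar w, hitT N w 1 == Some (plen w) & w`_(plen w) == 2 ^+ N].

Definition Wminus (N : nat) (w : seq int) : bool :=
  [&& Wstar w, hitT N w 1 == Some (plen w) & w`_(plen w) == - 2 ^+ N].

(* The normalised j-th segment of w at scale 2^N, for 1 <= j; it is only used
   when T_{j-1}^N(w) and T_j^N(w) are finite. *)
Definition segment (N : nat) (w : seq int) (j : nat) : seq int :=
  let a := odflt 0%N (hitT N w j.-1) in
  let b := odflt 0%N (hitT N w j) in
  [seq sgz (w`_b - w`_a) * (w`_(a + i) - w`_a) | i <- iota 0 (b - a).+1].

Section PathMeasures.
Variable R : realType.
Implicit Types u : R.

Definition xu u : R := 2 / (1 + Num.sqrt (1 + 8 * u ^+ 2)).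

Definition P1plus u (w : seq int) : R := u ^+ (plen w - 2) * xu u ^+ (plen w - 1).

(* Pplus u N w is P^u_{N,+}({w}) for 1 <= N and w in W_{N,+}; other values are
   irrelevant. *)
Fixpoint Pplus u (N : nat) (w : seq int) : R :=
  if N is N'.+1 then
    if N' == 0%N then P1plus u w
    else P1plus u (coarsen N' w) *
         \prod_(1 <= j < (plen (coarsen N' w)).+1) Pplus u N' (segment N' w j)
  else 0.

Definition Pminus u (N : nat) (w : seq int) : R :=
  Pplus u N [seq - x | x <- w].

End PathMeasures.

Definition Winf_set : set (nat -> int) :=
  [set om | om 0%N = 0 /\ forall i, `|om i - om i.+1| = 1].

Definition Winf := set_type Winf_set.

Definition zigzag (i : nat) : int := (odd i)%:Z.

Lemma zigzag_Winf : zigzag \in Winf_set.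
Proof. by apply/mem_set; split => //= i; rewrite /zigzag /=; case: (odd i). Qed.

HB.instance Definition _ := Choice.on Winf.
HB.instance Definition _ :=
  isPointed.Build Winf (exist (fun om => om \in Winf_set) zigzag zigzag_Winf).

Definition cylinder (w : seq int) : set Winf :=
  [set om | forall j, (j <= plen w)%N -> val om j = w`_j].

Definition Winf_mt := g_sigma_algebraType [set cylinder w | w in Wstar].

Definition is_Pu (R : realType) (u : R) (P : probability Winf_mt R) : Prop :=
  forall N w, (1 <= N)%N ->
    (Wplus N w -> P (cylinder w) = (2^-1 * Pplus u N w)%:E) /\
    (Wminus N w -> P (cylinder w) = (2^-1 * Pminus u N w)%:E).

(* The points visited strictly before the hitting time of {2^n, -2^n}; they
   all lie in ]-2^n, 2^n[, so this set is finite. *)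
Definition visited (n : nat) (om : Winf) : set int :=
  [set z | exists2 j, val om j = z &
     forall i, (i <= j)%N -> val om i != 2 ^+ n /\ val om i != - 2 ^+ n].

Definition Rn (n : nat) (om : Winf) : nat := #|` fset_set (visited n om)|.

Definition Xn (R : realType) (n : nat) (om : Winf) : R :=
  (Rn n om)%:R / 2 ^+ n - 1.

Definition converges_weakly d (Om : measurableType d) (R : realType)
    (P : probability Om R) (X : nat -> Om -> R)
    (mu : probability (measurableTypeR R) R) : Prop :=
  forall f : R -> R, continuous f -> (exists M : R, forall x, `|f x| <= M) ->
    ('E_P[f \o X n] @[n --> \oo] --> \int[mu]_x (f x)%:E)%E.

Section Hausdorff.
Variable R : realType.
Local Open Scope ereal_scope.
Implicit Types (U K : set R) (s : R).

(* ediam set0 = -oo *)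
Definition ediam U : \bar R := ereal_sup [set `|x - y|%:E | x in U & y in U].

(* diam(U)^s, where the empty set has value 0 also when s = 0 *)
Definition hgauge s U : \bar R := if `[< U = set0 >] then 0 else ediam U `^ s.

Definition hausdorff_content s (delta : R) K : \bar R :=
  ereal_inf [set \sum_(0 <= i <oo) hgauge s (U i) | U in
    [set U : (set R)^nat |
      K `<=` \bigcup_i U i /\ forall i, ediam (U i) <= delta%:E]].

Definition hausdorff_measure s K : \bar R :=
  ereal_sup [set hausdorff_content s delta K | delta in [set x : R | (0 < x)%R]].

Definition dimH K : \bar R :=
  ereal_inf [set s%:E | s in [set s | (0 <= s)%R /\ hausdorff_measure s K = 0]].

Definition dimH_measure (mu : probability (measurableTypeR R) R) : \bar R :=
  ereal_inf [set dimH K | K in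
    [set K : set (measurableTypeR R) |
      [/\ measurable K, K `<=` `[0%R, 1%R] & mu K = 1]]].

End Hausdorff.

Definition entropy (R : realType) (p : R) : R :=
  - p * ln p - (1 - p) * ln (1 - p).

(* Main.v *)
Require Import Defs.
From HB Require Import structures.
From mathcomp Require Import all_boot all_order all_algebra finmap.
From mathcomp Require Import all_classical all_reals all_analysis.
From mathcomp Require Import zify ring lra.

Set Implicit Arguments.
Unset Strict Implicit.
Unset Printing Implicit Defensive.

Import Order.TTheory GRing.Theory Num.Theory numFieldNormedType.Exports.

Local Open Scope classical_set_scope.
Local Open Scope ring_scope.

(** Write x for x_u, q = (1 - x) / 2 and c = 2 x / (1 + x).  A path that hits 2^n
before -2^n visits all of 0, ..., 2^n - 1 before it does, so R_n / 2^n - 1 is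
2^-n times the depth reached by the path below 0 (and symmetrically for -2^n).
Let G_N(j) be the P_{N,+}-probability that the path stays above -j.  Under
P_{1,+} a coarse path makes a geometric number of excursions to +1 or -1, each
of weight u^2 x^2 = q, so that conditioning on the coarse path at scale 2^N
gives, for j <= 2^N and for j = 2^N + i respectively,
   G_{N+1}(j) = x g / (1 - q g), g = G_N(j), and
   G_{N+1}(j) = x / (1 - q (1 + g)), g = G_N(i).
In the first case no excursion may go to -1 and every passage from 0 to 1 has
to stay above -j; in the second case the only constraint bears on the passages
from -1 to 0.  These recursions are consistent under doubling, so
the distribution function G of the limit law satisfies the functional equation
of de Rham type G(t/2) = f(G(t)), G((1+t)/2) = h(G(t)) with f and h Moebius.

The mass of a dyadic interval is therefore a product of conditional digit
probabilities driven by one real state w, the parameter of the Moebius map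
T_w(z) = (1 + w) z / (1 + w z) that normalises the current branch of G: the
next binary digit is 0 with probability c (1 + w) / (1 + c w), and w moves to
x w - q or to -(1 - c) / (1 + c w) according to the digit
([cascade_range_cdf]).  Starting from 0 the state stays in a compact part of
]-1, 0] as soon as x > 1/3, that is u < sqrt 3, and in [-1/2, 0] when
x >= 1/2; in the latter case the probability of the digit 0 lies in [x, c].

The probabilistic input is only an upper bound, the closed dyadic intervals
having at most the mass of the cascade ([limit_dyad_mass]).  For the path
measures it suffices to count finitely many explicit paths, with at most K
excursions at every scale: their total probability tends to 1 with K
([above_sum_cvg]), so everything else is negligible, and weak convergence is
used through a continuous tent function ([limit_dyad_le]).

The dimension estimates are of Chernoff type: sums over a level of dyadic
intervals of multiplicative quantities are controlled one digit at a time
([sum_cascade_le]).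
 - If psi is a cascade with level sums at most Lam^n, then at most Lam^n
   intervals have psi >= 1; when those carry almost all the mass, the limit law
   has dimension at most log Lam / log 2 ([dimH_measure_le]).  For u < 1, psi is
   the Bernoulli measure of parameter x inflated by e^(a n), a > s(x).
 - For u <> 1, psi is the mass itself, inflated by th^(-n), th > 1/2.  The sum of
   the square roots of the masses grows strictly slower than sqrt 2 ^ n because a fair
   digit equal to 0 is not followed by another fair digit: a digit is fair at one
   state w* only, and w* is a fixed point of w -> x w - q only if x = 1/2
   ([two_step_sqrt_sum]).
 - If all but summably many of the intervals have mass at most Lam^(-n), a set
   of dimension less than log Lam / log 2 is null by the mass distribution
   principle ([measure0_dimH_lt]); the entropy bound comes from the
   probability of 0 lying in [1 - c, c] ([powR_pair_le]). *)

(** * Paths stopped at a scale and their concatenation *)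

Lemma ohead_filter_iota (P : pred nat) a b p : (a < b <= p)%N -> P b ->
  (forall j, (a < j < b)%N -> ~~ P j) ->
  ohead [seq j <- iota a.+1 (p - a) | P j] = Some b.
Proof.
move=> /andP[ab bp] Pb nP.
have -> : (p - a = (b - a.+1) + (p - b).+1)%N by lia.
rewrite iotaD filter_cat (_ : a.+1 + (b - a.+1) = b)%N; last by lia.
rewrite (_ : [seq j <- iota a.+1 (b - a.+1) | P j] = [::]) /= ?Pb //.
apply/eqP; rewrite -[_ == _]negbK -has_filter; apply/hasPn => j.
rewrite mem_iota => /andP[aj jb]; apply: nP; lia.
Qed.

Lemma ohead_filter_iotaP (P : pred nat) a b p :
  ohead [seq j <- iota a.+1 (p - a) | P j] = Some b ->
  [/\ (a < b <= p)%N, P b & forall j, (a < j < b)%N -> ~~ P j].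
Proof.
case: (pselect (exists j, (a < j <= p)%N && P j)) => [ex|nex].
  case: (ex_minnP ex) => m /andP[/andP[am mp] Pm] mmin.
  rewrite (@ohead_filter_iota P a m p) ?am ?mp //; last first.
    move=> j /andP[aj jm]; apply: contraT; rewrite negbK => Pj.
    have := mmin j; rewrite aj Pj (ltnW (leq_trans jm mp)) /=.
    by move/(_ isT); rewrite leqNgt jm.
  case=> <-; split => // [|j /andP[aj jm]]; first by rewrite am mp.
  apply: contraT; rewrite negbK => Pj.
  have := mmin j; rewrite aj Pj (ltnW (leq_trans jm mp)) /=.
  by move/(_ isT); rewrite leqNgt jm.
rewrite (_ : [seq j <- _ | _] = [::]) //.
apply/eqP; rewrite -[_ == _]negbK -has_filter; apply/hasPn => j.
rewrite mem_iota => /andP[aj jb]; apply/negP => Pj; apply: nex.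
by exists j; rewrite Pj aj andbT /=; lia.
Qed.

Definition unit_step (a b : int) := `|a - b| == 1.

(** The first entrance into 2^N Z minus 0 of the path b followed by e is at e.
The end point is kept apart from the body b so that concatenating paths is list
concatenation of bodies: the end of a block is the start of the next one. *)
Record exits (N : nat) (e : int) (b : seq int) : Prop := Exits {
  exits_size : (0 < size b)%N;
  exits_start : b`_0 = 0;
  exits_path : path unit_step 0 (behead (rcons b e));
  exits_int : forall y, y \in b -> (2 ^+ N %| y)%Z -> y = 0 }.

Lemma exitsP N e b : e != 0 -> (2 ^+ N %| e)%Z ->
  exits N e b <-> (Wstar (rcons b e) /\ hitT N (rcons b e) 1 = Some (size b)).
Proof.
move=> e0 Ne; split=> [[sb b0 pb ib]|[]].
  split; first by case: b sb b0 pb {ib} => //= x b _ -> ->; rewrite eqxx.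
  rewrite /= /plen size_rcons /= subn0 -{1}(subn0 (size b)).
  apply: ohead_filter_iota; rewrite ?sb ?leqnn //.
    by rewrite nth_rcons ltnn eqxx Ne nth_rcons sb b0 e0.
  move=> j /andP[j0 jb]; rewrite !nth_rcons jb sb b0; apply/negP => /andP[Nj].
  by rewrite (ib _ (mem_nth _ jb) Nj) eqxx.
case: b => [|x b]; first by rewrite /= (negbTE e0).
move=> /= /andP[/eqP-> pb]; rewrite /plen /= size_rcons.
rewrite -{1}(subn0 (size b).+1).
move=> /ohead_filter_iotaP [_ _ h]; split => //.
move=> y; rewrite inE => /orP[/eqP->//|yb] Ny.
have : (0 < (index y b).+1 < (size b).+1)%N.
  by rewrite !ltnS leq0n index_mem.
move=> /h.
rewrite -rcons_cons nth_rcons /= ltnS index_mem yb nth_index // Ny /=.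
by rewrite negbK => /eqP.
Qed.

(** A block (s, b) is a path of W_{N,+} with body b, run in the direction s; the
positions of the concatenation are shifted to start at a. *)
Fixpoint glue N (a : int) (l : seq (int * seq int)) : seq int :=
  if l is (s, b) :: l' then
    [seq a + s * y | y <- b] ++ glue N (a + s * 2 ^+ N) l'
  else [::].

Definition glue_end (N : nat) (a : int) (l : seq (int * seq int)) : int :=
  a + (\sum_(p <- l) p.1) * 2 ^+ N.

Definition blocks N (l : seq (int * seq int)) :=
  forall p, p \in l -> (p.1 = 1 \/ p.1 = -1) /\ exits N (2 ^+ N) p.2.

Definition glue_time (l : seq (int * seq int)) j := sumn [seq size p.2 | p <- take j l].

Lemma glue_cat N a l1 l2 :
  glue N a (l1 ++ l2) = glue N a l1 ++ glue N (glue_end N a l1) l2.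
Proof.
elim: l1 a => [|[s b] l1 IH] a /=; first by rewrite /glue_end big_nil mul0r addr0.
rewrite IH catA; congr (_ ++ glue _ _ _).
by rewrite /glue_end big_cons /= mulrDl addrA.
Qed.

Lemma size_glue N a l : size (glue N a l) = glue_time l (size l).
Proof.
rewrite /glue_time take_size; elim: l a => //= -[s b] l IH a.
by rewrite size_cat size_map IH.
Qed.

Lemma size_glue_take N a l j : size (glue N a (take j l)) = glue_time l j.
Proof. by rewrite size_glue /glue_time take_size. Qed.

Lemma glue_timeS l j : (j < size l)%N ->
  glue_time l j.+1 = (glue_time l j + size (nth (0%:Z, [::]) l j).2)%N.
Proof.
by move=> jl; rewrite /glue_time (take_nth (0%:Z, [::]) jl) map_rcons sumn_rcons.
Qed.

Lemma glue_time0 l : glue_time l 0 = 0%N. Proof. by rewrite /glue_time take0. Qed.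

Section Glue.
Variables (N : nat) (a : int) (l : seq (int * seq int)).
Hypothesis hl : blocks N l.
Let L := size l.
Let w := rcons (glue N a l) (glue_end N a l).
Let block_start j := glue_end N a (take j l).
Let block j := nth (0%:Z, [::]) l j.

(** The bound on i is not strict: at its last point a block agrees with the start
of the following one. *)
Lemma glue_nth j i : (j < L)%N -> (i <= size (block j).2)%N ->
  w`_(glue_time l j + i) = block_start j + (block j).1 * (rcons (block j).2 (2 ^+
    N))`_i.
Proof.
move=> jL ij.
have e : l = take j l ++ block j :: drop j.+1 l.
  by rewrite -drop_nth // cat_take_drop.
rewrite /w {1}e glue_cat /= -(size_glue_take N a) -/(block_start j) rcons_cat.
rewrite nth_cat ltnNge leq_addr /= addKn.
case eb : (block j) => [s b] /=;
  have sz : size [seq block_start j + s * y | y <- b] = size b by rewrite size_map.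
rewrite rcons_cat nth_cat sz.
move: ij; rewrite leq_eqVlt eb /= => /orP[/eqP->|ib]; last first.
  by rewrite ib (nth_map 0) // nth_rcons ib.
rewrite ltnn subnn [in RHS]nth_rcons ltnn eqxx.
have -> : glue_end N a l = glue_end N (block_start j + s * 2 ^+ N) (drop j.+1 l).
  rewrite /block_start /glue_end {1}e big_cat big_cons eb /= !mulrDl !addrA //.
have [h|] := boolP (size l <= j.+1)%N;
  first by rewrite drop_oversize //= /glue_end big_nil mul0r addr0.
rewrite -ltnNge => h; rewrite (drop_nth (0%:Z, [::]) h).
have := hl (mem_nth (0%:Z, [::]) h); case: (nth _ _ _) => s' b' [/= _ []].
by case: b' => //= y b' _ -> _ _; rewrite mulr0 addr0.
Qed.

Lemma block_sign j : (j < L)%N -> (block j).1 = 1 \/ (block j).1 = -1.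
Proof. by move=> jL; case: (hl (mem_nth (0%:Z, [::]) jL)). Qed.

Lemma block_exits j : (j < L)%N -> exits N (2 ^+ N) (block j).2.
Proof. by move=> jL; case: (hl (mem_nth (0%:Z, [::]) jL)). Qed.

Lemma glue_nth_time j : (j <= L)%N -> w`_(glue_time l j) = block_start j.
Proof.
rewrite leq_eqVlt => /orP[/eqP->|jL].
  rewrite /w nth_rcons size_glue ltnn eqxx /block_start take_oversize //.
have := @glue_nth j 0 jL (leq0n _); rewrite addn0 => ->.
have [sb b0 _ _] := block_exits jL.
by rewrite nth_rcons sb b0 mulr0 addr0.
Qed.

Lemma block_startS j : (j < L)%N ->
  block_start j.+1 = block_start j + (block j).1 * 2 ^+ N.
Proof.
move=> jL; rewrite /block_start (take_nth (0%:Z,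
  [::]) jL) /glue_end -cats1 big_cat big_seq1 /=.
by rewrite mulrDl addrA.
Qed.

Lemma glue_time_le j : (j <= L)%N -> (glue_time l j <= glue_time l L)%N.
Proof.
move=> jL; rewrite -(subnKC jL); elim: (L - j)%N {jL} => [|k IH];
  first by rewrite addn0.
apply: (leq_trans IH); rewrite addnS.
have [h|h] := ltnP (j + k) L; first by rewrite (glue_timeS h) leq_addr.
by rewrite /glue_time !take_oversize // leqW.
Qed.

Lemma plen_glue : plen w = glue_time l L.
Proof. by rewrite /plen size_rcons size_glue. Qed.

Hypothesis Na : (2 ^+ N %| a)%Z.

Lemma block_start_dvd j : (2 ^+ N %| block_start j)%Z.
Proof. by rewrite rpredD // dvdz_mull. Qed.

(** Inside a block the path meets 2^N Z only at the starting point of the block,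
hence the T_j^N are exactly the junction times. *)
Lemma hitT_glue j : (j <= L)%N -> hitT N w j = Some (glue_time l j).
Proof.
elim: j => [|j IH] jL; first by rewrite glue_time0.
rewrite /= IH ?(ltnW jL) //.
have [sb b0 _ ib] := block_exits jL.
apply: ohead_filter_iota.
- by rewrite plen_glue glue_time_le // andbT glue_timeS //
    -[X in (X < _)%N]addn0 ltn_add2l.
- rewrite !glue_nth_time ?(ltnW jL) // block_start_dvd block_startS //=.
  rewrite -subr_eq0 addrAC subrr add0r; apply: mulf_neq0; last by apply: expf_neq0.
  by case: (block_sign jL) => ->.
- move=> i /andP[ti]; rewrite glue_timeS // => it.
  rewrite -(subnKC (ltnW ti)) glue_nth_time ?(ltnW jL) //.
  have ib' : (i - glue_time l j < size (block j).2)%N by rewrite ltn_subLR // ltnW.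
  rewrite glue_nth // ?(ltnW ib') // nth_rcons ib'.
  apply/negP => /andP[]; rewrite rpredDl ?block_start_dvd // => d.
  rewrite (ib _ (mem_nth _ ib')) ?mulr0 ?addr0 ?eqxx //.
  by case: (block_sign jL) d => ->; rewrite ?mul1r // mulN1r rpredN.
Qed.

Lemma hitT_glue_None j : (L < j)%N -> hitT N w j = None.
Proof.
elim: j => // j IH; rewrite ltnS leq_eqVlt => /orP[/eqP <-|/IH /= -> //].
by rewrite /= hitT_glue // plen_glue subnn.
Qed.

End Glue.

Lemma exits0 b : exits 0 1 b -> b = [:: 0].
Proof.
case=> sb b0 pb ib; case: b sb b0 pb ib => //= x b _ ->.
case: b => //= y b /andP[ny _] ib; exfalso.
have := ib y; rewrite !inE eqxx orbT => /(_ isT).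
by rewrite dvd1z => /(_ isT) y0; move: ny; rewrite y0.
Qed.

Section GlueAnalysis.
Variables (N : nat) (l : seq (int * seq int)).
Hypothesis hl : blocks N l.
Let L := size l.
Let w := rcons (glue N 0 l) (glue_end N 0 l).

Let N0 : (2 ^+ N %| 0)%Z. Proof. exact: dvdz0. Qed.

(** This makes room in [iota 0 (size w)], the range of indices scanned by
[coarsen], for all the junction times. *)
Lemma leq_glue_time : (L <= glue_time l L)%N.
Proof.
rewrite /glue_time take_size /L; elim: l hl => //= p l' IH hl'.
have [_ [sp _ _ _]] := hl' p (mem_head _ _).
rewrite -add1n leq_add // IH // => p' p'l; apply: hl'.
by rewrite inE p'l orbT.
Qed.

Lemma plen_coarsen_glue : plen (coarsen N w) = L.
Proof.
rewrite /coarsen /plen size_pmap size_rcons size_glue.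
have -> : ((glue_time l (size l)).+1 = L.+1 + (glue_time l L - L))%N.
  by rewrite addSn subnKC // leq_glue_time.
rewrite iotaD count_cat.
rewrite (_ : count _ (iota 0 L.+1) = L.+1); last first.
  rewrite -[RHS](size_iota 0) -[RHS]count_predT; apply: eq_in_count => j.
  by rewrite mem_iota add0n ltnS => /andP[_ jL] /=; rewrite hitT_glue.
rewrite (_ : count _ (iota _ _) = 0%N) ?addn0 //.
rewrite -[RHS](count_pred0 (iota (0 + L.+1) (glue_time l L - L))).
apply: eq_in_count => j.
by rewrite mem_iota add0n => /andP[Lj _] /=; rewrite hitT_glue_None.
Qed.

Lemma segment_glue j : (j < L)%N ->
  segment N w j.+1 = rcons (nth (0%:Z, [::]) l j).2 (2 ^+ N).
Proof.
move=> jL; rewrite /segment /= -/(hitT N w j.+1) !hitT_glue ?(ltnW jL) //=.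
rewrite glue_timeS // addKn.
have -> : sgz (w`_(glue_time l j + size (nth (0%:Z, [::]) l j).2) - w`_(glue_time l j))
   = (nth (0%:Z, [::]) l j).1.
  rewrite -glue_timeS // !glue_nth_time ?(ltnW jL) // block_startS //
    addrAC subrr add0r.
  rewrite sgzM (gtr0_sgz (_ : 0 < 2 ^+ N)) ?exprn_gt0 // mulr1.
  by case: (block_sign hl jL) => ->.
rewrite -[RHS](mkseq_nth 0) /mkseq size_rcons.
rewrite -[LHS]/(map (fun i => _ * (w`_(_ + i) - w`_(glue_time l j))) (iota 0 _.+1)).
apply/eq_in_map => i.
rewrite mem_iota add0n => /andP[_ ib].
rewrite glue_nth_time ?(ltnW jL) // glue_nth //.
rewrite addrAC subrr add0r mulrA.
by case: (block_sign hl jL) => ->; rewrite ?mulN1r ?opprK ?mul1r.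
Qed.

Lemma sign_glue j : (j < L)%N -> (nth (0%:Z, [::]) l j).1 =
  sgz (w`_(odflt 0%N (hitT N w j.+1)) - w`_(odflt 0%N (hitT N w j))).
Proof.
move=> jL; rewrite !hitT_glue ?(ltnW jL) //=.
rewrite !glue_nth_time ?(ltnW jL) // block_startS // addrAC subrr add0r.
rewrite sgzM (gtr0_sgz (_ : 0 < 2 ^+ N)) ?exprn_gt0 // mulr1.
by case: (block_sign hl jL) => ->.
Qed.

End GlueAnalysis.

(** [coarsen] and [segment] recover the number of blocks, their directions and
their bodies from the glued path. *)
Lemma glue_inj N l l' : blocks N l -> blocks N l' -> glue_end N 0 l = glue_end N 0 l' ->
  glue N 0 l = glue N 0 l' -> l = l'.
Proof.
move=> hl hl' ee bb.
have sz : size l = size l'.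
  by rewrite -(plen_coarsen_glue hl) -(plen_coarsen_glue hl') ee bb.
apply: (@eq_from_nth _ (0%:Z, [::])) => // j jl.
have jl' : (j < size l')%N by rewrite -sz.
have := sign_glue hl jl; rewrite ee bb -(sign_glue hl' jl').
have := segment_glue hl jl; rewrite ee bb (segment_glue hl' jl').
by case: (nth _ _ _) => [s b]; case: (nth _ _ _) => [s' b'] /= /rcons_inj [-> ->].
Qed.

Lemma unit_step_affine (a s x y : int) : s = 1 \/ s = -1 ->
  unit_step (a + s * x) (a + s * y) = unit_step x y.
Proof.
move=> hs; rewrite /unit_step opprD addrACA subrr add0r -mulrBr normrM.
by case: hs => ->; rewrite ?normrN normr1 mul1r.
Qed.

Lemma glue_path N a l e : blocks N l -> e = glue_end N a l -> (0 < size l)%N ->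
  (glue N a l)`_0 = a /\ path unit_step a (behead (rcons (glue N a l) e)).
Proof.
move=> hl ->; elim: l a hl => // -[s b] l IH a hl _ /=.
have [/= hs [sb b0 pb _]] := hl _ (mem_head _ _).
case: b sb b0 pb hl => // y b _ /= y0; rewrite {}y0 => pb hl.
rewrite mulr0 addr0; split=> //.
have pm : path unit_step a (rcons [seq a + s * y | y <- b] (a + s * 2 ^+ N)).
  have h : relpre (fun y => a + s * y) unit_step =2 unit_step by move=> x z;
    rewrite /= unit_step_affine.
  by move: pb; rewrite -(eq_path h) -path_map /= mulr0 addr0 map_rcons.
case: l IH hl => [_ _|p l IH hl].
  by rewrite /= cats0 /glue_end big_seq1.
have hl' : blocks N (p :: l) by move=> q ql; apply: hl; rewrite inE ql orbT.
have [b0 pp] := IH (a + s * 2 ^+ N) hl' isT.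
rewrite rcons_cat cat_path.
have -> : glue_end N a ((s, 0 :: b) :: p :: l) = glue_end N (a + s * 2 ^+ N) (p :: l).
  by rewrite /glue_end (big_cons _ _ (s, _)) mulrDl addrA.
move: b0 pp; set c := a + _; set B := glue _ _ _.
have : (0 < size B)%N.
  have [_ [sp _ _ _]] := hl' p (mem_head _ _).
  by rewrite /B; case: (p) sp => s' b' /= sp; rewrite size_cat size_map ltn_addr.
case: B => // z B _ /= -> pz.
by rewrite rcons_path in pm; case/andP: pm => -> nz; rewrite /= nz.
Qed.

Lemma glue_mem N a l y : y \in glue N a l -> exists l1 p l2 z,
  [/\ l = l1 ++ p :: l2, z \in p.2 & y = glue_end N a l1 + p.1 * z].
Proof.
elim: l a => // -[s b] l IH a /=; rewrite mem_cat => /orP[|/IH].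
  move=> /mapP[z zb ->]; exists [::], (s, b), l, z.
  by rewrite /glue_end big_nil mul0r addr0.
move=> [l1 [p [l2 [z [-> zp ->]]]]]; exists ((s, b) :: l1), p, l2, z.
by split=> //; rewrite /glue_end big_cons /= mulrDl addrA.
Qed.

(** The sign patterns whose partial sums form a path of W_{1,+}; parity is
enough to express that 0 is the only even value before the end. *)
Definition skeleton (l : seq (int * seq int)) :=
  (forall l1 p l2, l = l1 ++ p :: l2 ->
     (2 %| \sum_(q <- l1) q.1)%Z -> \sum_(q <- l1) q.1 = 0) /\
  \sum_(q <- l) q.1 = 2.

(** A point of 2^{N+1} Z on the glued path is in particular a point of 2^N Z,
hence a junction, and there the position is 2^N times a partial sum of signs. *)
Lemma exits_glue N l : blocks N l -> skeleton l -> exits N.+1 (2 ^+ N.+1) (glue N 0 l).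
Proof.
move=> hl [hs s2].
have ee : glue_end N 0 l = 2 ^+ N.+1 by rewrite /glue_end s2 add0r exprS.
have l0 : (0 < size l)%N.
  by rewrite lt0n; apply: contra_eq_neq s2 => /size0nil ->; rewrite big_nil.
have [b0 pb] := glue_path hl (erefl (glue_end N 0 l)) l0.
split=> //.
- by rewrite size_glue (leq_trans l0 (leq_glue_time hl)).
- by rewrite -ee.
- move=> y /glue_mem [l1 [p [l2 [z [el zp ->]]]]].
  have [hp [_ _ _ ip]] : (p.1 = 1 \/ p.1 = -1) /\ exits N (2 ^+ N) p.2.
    by apply: hl; rewrite el mem_cat inE eqxx orbT.
  rewrite /glue_end add0r => d.
  have d' : (2 ^+ N %| (\sum_(p0 <- l1) p0.1) * 2 ^+ N + p.1 * z)%Z.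
    by apply: (dvdz_trans _ d); rewrite exprS dvdz_mull.
  have z0 : z = 0.
    apply: ip => //; move: d'; rewrite rpredDl; last by rewrite dvdz_mull.
    by case: hp => ->; rewrite ?mul1r // mulN1r rpredN.
  move: d; rewrite z0 mulr0 addr0 exprS dvdz_mul2r; last exact: expf_neq0.
  by move=> /(hs _ _ _ el) ->; rewrite mul0r.
Qed.

Lemma exits_Wplus N b : exits N (2 ^+ N) b -> Wplus N (rcons b (2 ^+ N)).
Proof.
move=> eb; have [||hW hT] := (@exitsP N (2 ^+ N) b _ _).1 eb.
- exact: expf_neq0.
- exact: dvdzz.
by rewrite /Wplus hW hT /plen size_rcons nth_rcons ltnn !eqxx.
Qed.

(** * Finite families of stopped paths *)

(** By induction on time: a unit step cannot jump over 2^N or -2^N, which are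
reached only at the end. *)
Lemma exits_bound N b : exits N (2 ^+ N) b ->
  forall y, y \in b -> - 2 ^+ N < y < 2 ^+ N.
Proof.
case=> sb b0 pb ib.
have h : forall i, (i < size b)%N -> - 2 ^+ N < b`_i < 2 ^+ N.
  elim=> [|i IH] ib'.
    by rewrite b0 oppr_lt0 exprn_gt0 //=.
  have := IH (ltnW ib') => {}IH.
  have : unit_step b`_i b`_i.+1.
    move/(pathP 0) : pb => /(_ i).
    rewrite size_behead size_rcons => /(_ (ltnW ib')).
    rewrite nth_behead nth_rcons ib'.
    case: (b) sb b0 ib' => //= z b' _ -> ib'.
    by rewrite -rcons_cons nth_rcons ltnW.
  rewrite /unit_step => n1.
  have h1 : b`_i.+1 != 2 ^+ N.
    apply/eqP => e; have := ib _ (mem_nth 0 ib').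
    rewrite e dvdzz => /(_ isT) e0; by have := expf_neq0 N (isT : (2 : int) != 0);
      rewrite e0.
  have h2 : b`_i.+1 != - 2 ^+ N.
    apply/eqP => e; have := ib _ (mem_nth 0 ib').
    rewrite e rpredN dvdzz => /(_ isT) e0.
    by have := expf_neq0 N (isT : (2 : int) != 0); rewrite -oppr_eq0 e0.
  lia.
by move=> y yb; rewrite -(nth_index 0 yb) h // index_mem.
Qed.

(** The end point 2^N of a path is positive, so only the body matters. *)
Definition above (j : nat) (b : seq int) := all (fun y => - j%:Z < y) b.

Lemma Posz2X n : (2 ^ n)%N%:Z = 2 ^+ n.
Proof. by rewrite -natz natrX. Qed.

Lemma above_full N b : exits N (2 ^+ N) b -> above (2 ^ N) b.
Proof.
move=> /exits_bound h; apply/allP => y /h /andP[+ _].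
by rewrite Posz2X.
Qed.

Section Enum.
Variables (R : realType) (u : R).
Let x := xu u.

(** At scale 2^0 there is a single path, of probability 1; with this convention
the recursion for P_{N+1,+} also covers the case N = 0. *)
Definition path_prob N b : R := if N == 0%N then 1 else Pplus u N (rcons b (2 ^+ N)).

(** The weight of the coarse path depends on its length only. *)
Lemma path_prob_glue N l : blocks N l -> glue_end N 0 l = 2 ^+ N.+1 ->
  path_prob N.+1 (glue N 0 l) = u ^+ (size l - 2) * x ^+ (size l - 1) * \prod_(p <- l)
    path_prob N p.2.
Proof.
move=> hl el; rewrite /path_prob /=.
case: N hl el => [|N] hl el /=.
  rewrite big1 // mulr1 /P1plus /plen size_rcons size_glue /=.
  suff -> : glue_time l (size l) = size l by [].
  rewrite /glue_time take_size; elim: (l) hl => // p l' IH hl' /=.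
  have [_ /exits0 ->] := hl' p (mem_head _ _).
  by rewrite IH // => q ql; apply: hl'; rewrite inE ql orbT.
rewrite -el /P1plus (plen_coarsen_glue hl); congr (_ * _).
rewrite big_add1 /= (big_nth (0%:Z, [::])) !big_nat; apply: eq_bigr => j /andP[_ jl].
by rewrite segment_glue.
Qed.

Let body_pairs (B : seq (seq int)) := [seq (b1, b2) | b1 <- B, b2 <- B].

(** All ways to fill with blocks of B the coarse paths of W_{1,+} that make k
excursions from 0 before the two final steps to 2. *)
Fixpoint excursions (B : seq (seq int)) k : seq (seq (int * seq int)) :=
  if k is k'.+1 then
    [seq [:: (1, p.1), (-1, p.2) & l] | p <- body_pairs B, l <- excursions B k'] ++
    [seq [:: (-1, p.1), (1, p.2) & l] | p <- body_pairs B, l <- excursions B k']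
  else [seq [:: (1, p.1); (1, p.2)] | p <- body_pairs B].

Definition excursions_upto B K := flatten [seq excursions B k | k <- iota 0 K.+1].

(** Truncating the number of excursions at every scale keeps all sums finite. *)
Fixpoint exit_bodies N K : seq (seq int) :=
  if N is N'.+1 then [seq glue N' 0 l | l <- excursions_upto (exit_bodies N' K) K] else
    [:: [:: 0]].

Lemma body_pairsP B p : p \in body_pairs B -> p.1 \in B /\ p.2 \in B.
Proof. by move=> /allpairsP[[a b] /= [? ? ->]]. Qed.

Lemma excursions_skeleton N B k l : (forall b, b \in B -> exits N (2 ^+ N) b) ->
  l \in excursions B k -> [/\ blocks N l, skeleton l & size l = k.+1.*2].
Proof.
move=> hB; elim: k l => [|k IH] l.
  move=> /mapP[p /body_pairsP[p1 p2] ->]; split => //.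
  - move=> q; rewrite !inE => /orP[/eqP->|/eqP->] /=; (split; [by left|exact: hB]).
  - split; last by rewrite !big_cons big_nil.
    move=> [|a [|b [|c l1]]] q l2 //= [].
    + by rewrite big_nil.
    + by move=> <- _ _; rewrite big_seq1.
have step s p l' : (s = 1 \/ s = -1) -> p \in body_pairs B -> l' \in excursions B k ->
  [/\ blocks N [:: (s, p.1), (- s, p.2) & l'], skeleton [:: (s, p.1), (- s, p.2) & l']
    & size [:: (s, p.1), (- s, p.2) & l'] = k.+2.*2].
  move=> hs /body_pairsP[p1 p2] /IH[h1 [h2 h3] h4]; split.
  - move=> q; rewrite !inE => /or3P[/eqP->|/eqP->|/h1//] /=; split=> //; try exact: hB.
    by case: hs => ->; rewrite ?opprK; [right|left].
  - split; last by rewrite !big_cons h3 /= addrA subrr add0r.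
    move=> [|a [|b l1]] q l2 /=.
    + by rewrite big_nil.
    + by case=> <- _ _; rewrite big_seq1; case: hs => ->.
    + case=> <- <- e; rewrite !big_cons /= addrA subrr add0r; exact: h2 e.
  - by rewrite /= h4.
rewrite /= mem_cat => /orP[|] /allpairsP[[p l'] /= [hp hl' ->]].
  by apply: (step 1) => //; left.
by have := step (-1) p l' (or_intror erefl) hp hl'; rewrite opprK.
Qed.

Lemma excursions_uniq B k : uniq B -> uniq (excursions B k).
Proof.
move=> uB; have ue : uniq (body_pairs B) by apply: allpairs_uniq => // -[? ?] [? ?].
elim: k => [|k IH] /=.
  by rewrite map_inj_uniq // => -[? ?] [? ?] /= [-> ->].
have step (s t : int) :
    uniq [seq [:: (s, p.1), (t, p.2) & l] | p <- body_pairs B, l <- excursions B k].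
  apply: allpairs_uniq => //.
  by move=> [[? ?] ?] [[? ?] ?] _ _ /= [-> -> ->].
rewrite cat_uniq !step andbT /=; apply/hasPn => l /allpairsP[p [_ _ ->]].
by apply/negP => /allpairsP[q [_ _]].
Qed.

Lemma excursions_upto_uniq N B K : (forall b, b \in B -> exits N (2 ^+ N) b) ->
  uniq B -> uniq (excursions_upto B K).
Proof.
move=> hB uB; rewrite /excursions_upto; elim: K.+1 => // n IH.
rewrite -addn1 iotaD map_cat flatten_cat /= cats0 cat_uniq IH excursions_uniq //
  andbT /=.
apply/hasPn => l ln; apply/negP => /flatten_mapP[k].
rewrite mem_iota add0n => /andP[_ kn] lk.
have [_ _ s1] := excursions_skeleton hB ln; have [_ _ s2] := excursions_skeleton hB lk.
move: s1; rewrite s2; lia.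
Qed.

Lemma excursions_upto_skeleton N B K l : (forall b, b \in B -> exits N (2 ^+ N) b) ->
  l \in excursions_upto B K -> blocks N l /\ skeleton l.
Proof. by move=> hB /flatten_mapP[k _ /(excursions_skeleton hB)[]]. Qed.

Lemma glue_end_skeleton N l : skeleton l -> glue_end N 0 l = 2 ^+ N.+1.
Proof. by case=> _ s2; rewrite /glue_end s2 add0r exprS. Qed.

Lemma exit_bodies_exits N K b : b \in exit_bodies N K -> exits N (2 ^+ N) b.
Proof.
elim: N b => [|N IH] b /=.
  by rewrite inE => /eqP->; split=> // y; rewrite inE => /eqP->.
by move=> /mapP[l /(excursions_upto_skeleton IH)[hl hs] ->]; apply: exits_glue.
Qed.

Lemma exit_bodies_uniq N K : uniq (exit_bodies N K).
Proof.
elim: N => // N IH /=; rewrite map_inj_in_uniq.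
  exact: excursions_upto_uniq (@exit_bodies_exits N K) IH.
move=> l l' /(excursions_upto_skeleton (@exit_bodies_exits N K))[hl hs]
  /(excursions_upto_skeleton (@exit_bodies_exits N K))[hl' hs'].
by apply: glue_inj; rewrite ?glue_end_skeleton.
Qed.

End Enum.

(** * Sums over paths bounded below *)

(** The five kinds of steps of a coarse path of W_{1,+} are 0 to 1, 1 to 0, 1 to 2,
0 to -1 and -1 to 0.  Only those from 0 to 1 and from -1 to 0 carry a genuine
constraint: -j is below all values of the others, unless j <= 2^N and the path
goes to -1, which is then excluded by the starting point of the step back. *)
Section AboveShift.
Variables (N : nat) (b : seq int).
Hypothesis hb : exits N (2 ^+ N) b.

Lemma above_pos1 j : above j [seq 0 + 1 * y | y <- b] = above j b.
Proof. by rewrite /above all_map; apply: eq_all => y /=; rewrite add0r mul1r. Qed.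

Lemma above_pos2 j : above j [seq 0 + 1 * 2 ^+ N + -1 * y | y <- b] = true.
Proof.
by rewrite /above all_map; apply/allP => y /(exits_bound hb) /=; lia.
Qed.

Lemma above_fin2 j : above j [seq 0 + 1 * 2 ^+ N + 1 * y | y <- b] = true.
Proof.
by rewrite /above all_map; apply/allP => y /(exits_bound hb) /=; lia.
Qed.

Lemma above_neg1 j : (2 ^ N <= j)%N -> above j [seq 0 + -1 * y | y <- b] = true.
Proof.
move=> hj; have {hj} : 2 ^+ N <= j%:Z by rewrite -Posz2X.
by rewrite /above all_map => hj; apply/allP => y /(exits_bound hb) /=; lia.
Qed.

Lemma above_neg2_low j : (j <= 2 ^ N)%N ->
  above j [seq 0 + -1 * 2 ^+ N + 1 * y | y <- b] = false.
Proof.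
move=> hj; have {hj} hj : j%:Z <= 2 ^+ N by rewrite -Posz2X.
have [sb b0 _ _] := hb; rewrite /above all_map; apply/allPn; exists 0.
  by rewrite -b0 mem_nth.
by rewrite /=; lia.
Qed.

Lemma above_neg2_high j : (2 ^ N <= j)%N ->
  above j [seq 0 + -1 * 2 ^+ N + 1 * y | y <- b] = above (j - 2 ^ N) b.
Proof.
move=> hj; rewrite /above all_map; apply: eq_all => y /=.
have -> : (j - 2 ^ N)%N%:Z = j%:Z - 2 ^+ N by rewrite -subzn // Posz2X.
lia.
Qed.

Lemma above_high j : (2 ^ N <= j)%N -> above j b = true.
Proof.
move=> hj; have {hj} hj : 2 ^+ N <= j%:Z by rewrite -Posz2X.
by apply/allP => y /(exits_bound hb) /=; lia.
Qed.

End AboveShift.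

Lemma above_cat j b1 b2 : above j (b1 ++ b2) = above j b1 && above j b2.
Proof. exact: all_cat. Qed.

Section Sums.
Variables (R : realType) (u : R) (N : nat) (B : seq (seq int)).
Hypothesis hB : forall b, b \in B -> exits N (2 ^+ N) b.

Let A j b : R := (above j b)%:R.
Let path_prob := path_prob u.
Let W (l : seq (int * seq int)) := \prod_(p <- l) path_prob N p.2.
Let G j := \sum_(b <- B) A j b * path_prob N b.
Let T := \sum_(b <- B) path_prob N b.

Let sum_exs (F : seq int * seq int -> R) (g h : seq int -> R) :
  (forall b1 b2, b1 \in B -> b2 \in B -> F (b1, b2) = g b1 * h b2) ->
  \sum_(p <- [seq (b1, b2) | b1 <- B, b2 <- B]) F p =
  (\sum_(b <- B) g b) * (\sum_(b <- B) h b).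
Proof.
move=> hF; rewrite big_allpairs_dep big_distrl /= !big_seq; apply: eq_bigr => b1 h1.
rewrite big_distrr /= !big_seq; apply: eq_bigr => b2 h2; exact: hF.
Qed.

(** Below level 2^N: an excursion to -1 is excluded; one to +1 contributes G for
its outward step and T for its return, and so do the two final steps. *)
Lemma excursions_sum_low k j : (j <= 2 ^ N)%N ->
  \sum_(l <- excursions B k) A j (glue N 0 l) * W l = (G j * T) ^+ k.+1.
Proof.
move=> hj; elim: k => [|k IH] /=.
  rewrite big_map expr1; apply: sum_exs => b1 b2 h1 h2.
  rewrite /A /= cats0 above_cat above_pos1 (above_fin2 (hB h2)) andbT.
  by rewrite /W !big_cons big_nil /= mulr1 mulrA.
rewrite big_cat /= [X in X + _]big_allpairs_dep [X in _ + X]big_allpairs_dep [X in _ +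
  X]big1_seq ?addr0; last first.
  move=> [b1 b2] /= /body_pairsP[/= h1 h2].
  rewrite big1 // => l _; rewrite /A /= !above_cat (above_neg2_low (hB h2)) //.
  by rewrite andbF mul0r.
set S := (X in X = _) in IH *.
rewrite (@sum_exs _ (fun b => A j b * path_prob N b) (fun b => path_prob N b * S)) =>
  [|b1 b2 h1 h2].
  by rewrite -mulr_suml mulrA IH -exprS.
rewrite mulr_sumr mulr_sumr; apply: eq_bigr => l _.
rewrite /A /= !above_cat above_pos1 (above_pos2 (hB h2)) /=.
rewrite (_ : 0 + 1 * 2 ^+ N + -1 * 2 ^+ N = 0 :> int); last by rewrite mul1r mulN1r;
  lia.
by rewrite /W !big_cons /= -mulnb natrM; ring.
Qed.

(** Beyond level 2^N: positive excursions are free, negative ones are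
constrained through their return step only. *)
Lemma excursions_sum_high k j : (2 ^ N <= j)%N ->
  \sum_(l <- excursions B k) A j (glue N 0 l) * W l =
  (T * (T + G (j - 2 ^ N))) ^+ k * (T * T).
Proof.
move=> hj; elim: k => [|k IH] /=.
  rewrite big_map expr0 mul1r; apply: sum_exs => b1 b2 h1 h2.
  rewrite /A /= cats0 above_cat above_pos1 (above_high (hB h1)) //
    (above_fin2 (hB h2)) mul1r.
  by rewrite /W !big_cons big_nil /= mulr1.
rewrite big_cat /= [X in X + _]big_allpairs_dep [X in _ + X]big_allpairs_dep.
set S := (X in X = _) in IH.
rewrite (@sum_exs _ (path_prob N) (fun b => path_prob N b * S)) => [|b1 b2 h1 h2];
  last first.
  rewrite mulr_sumr mulr_sumr; apply: eq_bigr => l _.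
  rewrite /A /= !above_cat above_pos1 (above_high (hB h1)) // (above_pos2 (hB h2)) /=.
  rewrite (_ : 0 + 1 * 2 ^+ N + -1 * 2 ^+ N = 0 :> int); last by rewrite mul1r mulN1r;
    lia.
  by rewrite /W !big_cons /=; ring.
rewrite (@sum_exs _ (path_prob N) (fun b => A (j - 2 ^ N) b * path_prob N b * S)) =>
  [|b1 b2 h1 h2]; last first.
  rewrite mulr_sumr mulr_sumr; apply: eq_bigr => l _.
  rewrite /A /= !above_cat (above_neg1 (hB h1)) // above_neg2_high //=.
  rewrite (_ : 0 + -1 * 2 ^+ N + 1 * 2 ^+ N = 0 :> int); last by rewrite mul1r mulN1r;
    lia.
  by rewrite /W !big_cons /= -mulnb natrM; ring.
by rewrite -!mulr_suml -/T -/(G _) IH exprS; ring.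
Qed.

End Sums.

Section Limit.
Variables (R : realType) (u : R).
Hypothesis hu : 0 < u.
Let x := xu u.
Let q := (1 - x) / 2.

Lemma xu_sqrt_gt1 : 1 < Num.sqrt (1 + 8 * u ^+ 2).
Proof.
rewrite -[X in X < _]sqrtr1 ltr_sqrt; last by rewrite ltr_wpDr // mulr_ge0 // sqr_ge0.
by rewrite ltrDl mulr_gt0 // exprn_gt0.
Qed.

Lemma xu_gt0 : 0 < x.
Proof. by have := xu_sqrt_gt1 => h; rewrite /x /xu divr_gt0 //; lra. Qed.

Lemma xu_lt1 : x < 1.
Proof. by have := xu_sqrt_gt1 => h; rewrite /x /xu ltr_pdivrMr; lra. Qed.

(** x_u is the positive root of 2 u^2 x^2 + x - 1. *)
Lemma xu_eq : u ^+ 2 * x ^+ 2 = q.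
Proof.
rewrite /q /x /xu; set s := Num.sqrt _; have h : 1 < s := xu_sqrt_gt1.
have e : s ^+ 2 = 1 + 8 * u ^+ 2.
  by rewrite sqr_sqrtr // addr_ge0 // mulr_ge0 // sqr_ge0.
have -> : u ^+ 2 = (s ^+ 2 - 1) / 8 by rewrite e; field.
by field; lra.
Qed.

Definition above_sum N K j :=
  \sum_(b <- exit_bodies N K) (above j b)%:R * path_prob u N b.

Lemma above_sum_rec N K j : above_sum N.+1 K j =
  \sum_(k < K.+1) x * q ^+ k *
    \sum_(l <- excursions (exit_bodies N K) k) (above j (glue N 0 l))%:R * \prod_(p <-
      l) path_prob u N p.2.
Proof.
rewrite /above_sum /= big_map /excursions_upto big_flatten big_map -[iota 0
  K.+1]/(index_iota 0 K.+1).
rewrite big_mkord; apply: eq_bigr => k _; rewrite mulr_sumr !big_seq.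
apply: eq_bigr => l hl.
have [h1 h2 h3] := excursions_skeleton (@exit_bodies_exits N K) hl.
rewrite path_prob_glue ?glue_end_skeleton // h3 doubleS subSS !subSS !subn0.
have -> : q ^+ k = u ^+ k.*2 * x ^+ k.*2.
  by rewrite -[q]xu_eq exprMn -!exprM !mul2n.
by rewrite exprS -/x; ring.
Qed.

(** Every path of W_{N,+} stays above -2^N, so this is the total mass. *)
Lemma above_sum_full N K : above_sum N K (2 ^ N) = \sum_(b <- exit_bodies N K)
  path_prob u N b.
Proof.
rewrite /above_sum !big_seq; apply: eq_bigr => b hb.
by rewrite (above_full (exit_bodies_exits hb)) mul1r.
Qed.

Lemma above_sum_low N K j : (j <= 2 ^ N)%N ->
  let z := above_sum N K j * above_sum N K (2 ^ N) in
  above_sum N.+1 K j = x * z * \sum_(k < K.+1) (q * z) ^+ k.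
Proof.
move=> hj /=; rewrite above_sum_rec mulr_sumr; apply: eq_bigr => k _.
rewrite (excursions_sum_low u (@exit_bodies_exits N K)) //
  above_sum_full -/(above_sum N K j) exprS [(q * _) ^+ k]exprMn; ring.
Qed.

Lemma above_sum_high N K j : (2 ^ N <= j)%N ->
  let t := above_sum N K (2 ^ N) in
  above_sum N.+1 K j = x * t * t * \sum_(k < K.+1) (q * (t * (t + above_sum N K (j - 2
    ^ N)))) ^+ k.
Proof.
move=> hj /=; rewrite above_sum_rec mulr_sumr; apply: eq_bigr => k _.
rewrite (excursions_sum_high u (@exit_bodies_exits N K)) //
  above_sum_full [(q * _) ^+ k]exprMn /above_sum; ring.
Qed.

End Limit.

(** * The law of the minimum *)

Section Range.
Variables (R : realType) (x : R).

(** The limit of [above_sum] as the truncation is removed; j / 2^N maps to the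
distribution function of the limit law. *)
Fixpoint range_cdf N j : R :=
  if N is N'.+1 then
    if (j <= 2 ^ N')%N then x * range_cdf N' j / (1 - (1 - x) / 2 * range_cdf N' j)
    else x / (1 - (1 - x) / 2 * (1 + range_cdf N' (j - 2 ^ N')%N))
  else (0 < j)%N%:R.

Lemma range_cdfS N j : range_cdf N.+1 j = if (j <= 2 ^ N)%N
  then x * range_cdf N j / (1 - (1 - x) / 2 * range_cdf N j)
  else x / (1 - (1 - x) / 2 * (1 + range_cdf N (j - 2 ^ N)%N)).
Proof. by []. Qed.

Hypothesis x01 : 0 < x < 1.

Lemma range_cdf_itv N j : 0 <= range_cdf N j <= 1.
Proof.
elim: N j => [|N IH] j /=; first by case: (0 < j)%N; rewrite ?lexx ler01.
case: ifP => _; [have := IH j|have := IH (j - 2 ^ N)%N];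
  set g := range_cdf _ _ => /andP[g0 g1]; have /andP[x0 x1] := x01.
  have h : 0 < 1 - (1 - x) / 2 * g by nra.
  by rewrite ler_pdivrMr // mul1r divr_ge0 ?(ltW h) //; nra.
have h : 0 < 1 - (1 - x) / 2 * (1 + g) by nra.
by rewrite ler_pdivrMr // mul1r divr_ge0 ?(ltW h) //; nra.
Qed.

Lemma range_cdf0 N : range_cdf N 0 = 0.
Proof. by elim: N => //= N ->; rewrite mulr0 mul0r. Qed.

Lemma range_cdf_full N j : (2 ^ N <= j)%N -> range_cdf N j = 1.
Proof.
elim: N j => [|N IH] j; first by rewrite expn0 /= => ->.
rewrite expnS mul2n -addnn => hj.
have -> : range_cdf N.+1 j = x / (1 - (1 - x) / 2 * (1 + range_cdf N (j - 2 ^ N)%N)).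
  by rewrite /= leqNgt; case: ltnP => // h; move: (leq_trans hj h);
    rewrite -[X in (_ <= X)%N]addn0 leq_add2l leqn0 expn_eq0.
rewrite IH; last by rewrite leq_subRL // (leq_trans _ hj) // leq_addr.
by case/andP: x01 => x0 x1; field; lra.
Qed.

(** Both branches of the recursion are determined by the leading binary digit,
so a refinement by one digit at the other end is invisible. *)
Lemma range_cdf_double N j : range_cdf N.+1 j.*2 = range_cdf N j.
Proof.
elim: N j => [|N IH] j.
  case: j => [|j]; first by rewrite double0 !range_cdf0.
  by rewrite !range_cdf_full // expn1 doubleS.
by rewrite range_cdfS expnS mul2n leq_double -doubleB !IH range_cdfS.
Qed.

Lemma range_cdf_scale N n j : range_cdf (N + n) (j * 2 ^ n) = range_cdf N j.
Proof.
elim: n => [|n IH]; first by rewrite addn0 muln1.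
by rewrite addnS expnS mulnCA mul2n range_cdf_double.
Qed.

(** Both the ratio and the number of terms vary with n. *)
Lemma cvg_geom (y : R^nat) l : y @ \oo --> l -> (forall n, 0 <= y n) -> l < 1 ->
  (\sum_(k < n.+1) y n ^+ k) @[n --> \oo] --> (1 - l)^-1.
Proof.
move=> yl y0 l1.
pose r := (l + 1) / 2.
have r1 : r < 1 by rewrite /r; lra.
have yr : \forall n \near \oo, y n <= r.
  by apply: (cvgr_le l) => //; rewrite /r; lra.
have l0 : 0 <= l by apply: (cvgr_to_ge yl) => //; near=> n.
have p0 : y n ^+ n.+1 @[n --> \oo] --> (0 : R).
  apply: (@squeeze_cvgr _ _ _ _ (fun=> 0) (fun n => r ^+ n.+1)).
  - near=> n; rewrite exprn_ge0 //=; apply: lerXn2r; rewrite ?nnegrE //.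
      by rewrite /r; lra.
    by near: n.
  - exact: cvg_cst.
  - rewrite (cvg_shiftS (fun n => r ^+ n)); apply: cvg_expr.
    by rewrite ger0_norm // /r; lra.
have e : \forall n \near \oo, (1 - y n ^+ n.+1) / (1 - y n) = \sum_(k < n.+1) y n ^+ k.
  near=> n; have yn : y n <= r by near: n.
  have h : 1 - y n != 0 by apply/eqP; lra.
  apply: (mulIf h); rewrite divfK // -[RHS]opprK -mulrN opprB mulrC -subrX1 opprB //.
have h : (1 - y n ^+ n.+1) / (1 - y n) @[n --> \oo] --> (1 - 0) / (1 - l).
  apply: cvgM; first by apply: cvgB => //; exact: cvg_cst.
  apply: cvgV; first by apply/eqP; lra.
  by apply: cvgB => //; exact: cvg_cst.
rewrite subr0 mul1r in h; apply: cvg_trans h; exact: near_eq_cvg e.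
Unshelve. all: by end_near.
Qed.

End Range.

Section Limit.
Variables (R : realType) (u : R).
Hypothesis hu : 0 < u.

Lemma Pplus_ge0 N b : 0 <= Pplus u N b.
Proof.
have h c : 0 <= P1plus u c by rewrite mulr_ge0 // exprn_ge0 // ltW // xu_gt0.
elim: N b => //= N IH b; case: ifP => _; rewrite ?h // mulr_ge0 //.
by rewrite prodr_ge0.
Qed.

Lemma above_sum_ge0 N K j : 0 <= above_sum u N K j.
Proof.
rewrite /above_sum sumr_ge0 // => b _; rewrite mulr_ge0 // /path_prob.
by case: ifP => // _; exact: Pplus_ge0.
Qed.

Lemma above_sum_cvg N j : above_sum u N K j @[K --> \oo] --> range_cdf (xu u) N j.
Proof.
have x0 := xu_gt0 hu; have x1 := xu_lt1 hu.
have x01 : 0 < xu u < 1 by rewrite x0 x1.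
elim: N j => [|N IH] j.
  rewrite (_ : (fun K => _) = fun=> (0 < j)%N%:R); first exact: cvg_cst.
  apply/funext => K; rewrite /above_sum /= big_seq1 /path_prob mulr1 /above /= andbT.
  by rewrite oppr_lt0.
have IHf := IH (2 ^ N)%N; rewrite range_cdf_full // in IHf.
rewrite [range_cdf _ _ _]/=; case: leqP => hj.
  have /andP[g0 g1] := range_cdf_itv x01 N j.
  under eq_cvg do rewrite (above_sum_low hu _ hj).
  set g := range_cdf _ _ _ in g0 g1 *; set q := (1 - xu u) / 2.
  have h : above_sum u N K j * above_sum u N K (2 ^ N) @[K --> \oo] --> g * 1 by exact:
    cvgM.
  suff : xu u * (above_sum u N K j * above_sum u N K (2 ^ N)) *
      \sum_(k < K.+1) (q * (above_sum u N K j * above_sum u N K (2 ^ N))) ^+ k @[K -->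
        \oo]
      --> xu u * (g * 1) / (1 - q * (g * 1)) by rewrite mulr1.
  apply: cvgM; first by apply: cvgM => //; exact: cvg_cst.
  apply: cvg_geom.
  - by apply: cvgM => //; exact: cvg_cst.
  - by move=> n; rewrite !mulr_ge0 ?above_sum_ge0 // /q; lra.
  - by rewrite /q; nra.
have /andP[g0 g1] := range_cdf_itv x01 N (j - 2 ^ N).
under eq_cvg do rewrite (above_sum_high hu _ (ltnW hj)).
set g := range_cdf _ _ _ in g0 g1 *; set q := (1 - xu u) / 2.
suff : xu u * above_sum u N K (2 ^ N) * above_sum u N K (2 ^ N) *
    \sum_(k < K.+1) (q * (above_sum u N K (2 ^ N) * (above_sum u N K (2 ^ N) +
      above_sum u N K (j - 2 ^ N)))) ^+ k
    @[K --> \oo] --> xu u * 1 * 1 / (1 - q * (1 * (1 + g))) by rewrite mul1r !mulr1.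
apply: cvgM; first by apply: cvgM => //; apply: cvgM => //; exact: cvg_cst.
apply: cvg_geom.
- by apply: cvgM; [exact: cvg_cst|apply: cvgM => //; apply: cvgD; last exact: IH].
- move=> n; have q0 : 0 <= q by rewrite /q; lra.
  by rewrite (mulr_ge0 q0) // mulr_ge0 ?addr_ge0 ?above_sum_ge0.
- by rewrite /q; nra.
Qed.

End Limit.

(** * The range on the cylinder of a stopped path *)

(** Discrete intermediate value theorem. *)
Lemma unit_step_ivt a s y z : path unit_step a s -> y \in a :: s ->
  (a <= z <= y) || (y <= z <= a) ->
  z \in a :: s.
Proof.
elim: s a => [|c s IH] a; first by rewrite /= !inE => _ /eqP ->; lia.
move=> /= /andP[ac cs] ys hz; have [->|za] := eqVneq z a; first by rewrite inE eqxx.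
rewrite inE (negbTE za) /=; apply: IH => //.
  by move: ys; rewrite inE => /orP[/eqP ya|//]; exfalso; lia.
by move: ac hz; rewrite /unit_step; lia.
Qed.

Lemma exits_conn N b y z : exits N (2 ^+ N) b -> y \in b -> y <= z < 2 ^+ N -> z \in b.
Proof.
case=> sb b0 pb _ yb hz.
have : z \in rcons b (2 ^+ N).
  have eb : rcons b (2 ^+ N) = 0 :: behead (rcons b (2 ^+ N)).
    by case: (b) sb b0 => //= ? ? _ ->.
  have p2 : 0 < 2 ^+ N :> int by rewrite exprn_gt0.
  rewrite eb; have [z0|z0] := leP 0 z.
    apply: (@unit_step_ivt _ _ (2 ^+ N)) => //; first by rewrite -eb mem_rcons inE eqxx.
    by rewrite z0 ltW //; case/andP: hz.
  apply: (@unit_step_ivt _ _ y) => //; first by rewrite -eb mem_rcons inE yb orbT.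
  by apply/orP; right; rewrite (ltW z0) andbT; case/andP: hz.
by rewrite mem_rcons inE => /orP[/eqP zN|//]; move: hz; rewrite zN ltxx andbF.
Qed.

(** The values of the path form an integer interval with right end 2^N - 1,
whose cardinality determines its left end. *)
Lemma above_size_undup N b j : exits N (2 ^+ N) b ->
  above j b = (size (undup b) < 2 ^ N + j)%N.
Proof.
move=> eb; have p2 : 0 < 2 ^+ N :> int by rewrite exprn_gt0.
(* the m largest integers below 2^N *)
pose I m : seq int := [seq 2 ^+ N - 1 - (i%:Z) | i <- iota 0 m].
have uI m : uniq (I m).
  by rewrite map_inj_uniq ?iota_uniq // => i i'; lia.
have IP m z : (z \in I m) = (2 ^+ N - 1 - m%:Z < z <= 2 ^+ N - 1).
  apply/mapP/idP => [[i]|hz].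
    by rewrite mem_iota => hi ->; lia.
  by exists `|2 ^+ N - 1 - z|%N; rewrite ?mem_iota; lia.
have sI m : size (I m) = m by rewrite size_map size_iota.
have p2N := Posz2X N.
apply/idP/idP => [hab|].
  have b0 : 0 \in b by have [sb <- _ _] := eb; exact: mem_nth.
  have j0 : (0 < j)%N by have := allP hab _ b0; rewrite oppr_lt0.
  rewrite -(ltn_predK (_ : 0 < 2 ^ N + j)%N) ?addn_gt0 ?j0 ?orbT // ltnS.
  rewrite -[X in (_ <= X)%N](sI (2 ^ N + j).-1); apply: uniq_leq_size;
    first exact: undup_uniq.
  move=> y; rewrite mem_undup => yb; rewrite IP.
  have := allP hab _ yb; have := exits_bound eb yb => /=; lia.
apply: contraTT => /allPn[y yb]; rewrite -leNgt => yj; rewrite -leqNgt.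
rewrite -[X in (X <= _)%N](sI (2 ^ N + j)%N); apply: uniq_leq_size => // z.
rewrite IP mem_undup => hz; apply: (exits_conn eb yb); lia.
Qed.

Lemma cylinder_visited n (s : int) b om : s = 1 \/ s = -1 -> exits n (2 ^+ n) b ->
  cylinder (map (fun y => s * y) (rcons b (2 ^+ n))) om ->
  visited n om = [set` [seq s * y | y <- b]].
Proof.
move=> hs eb H; have hom j : (j <= size b)%N ->
    val om j = [seq s * y | y <- rcons b (2 ^+ n)]`_j.
  by move=> hj; apply: H; rewrite /plen size_map size_rcons.
have h i : (i < size b)%N -> val om i = s * b`_i.
  move=> ib; rewrite (hom _ (ltnW ib)) (nth_map 0);
    last by rewrite size_rcons ltnS ltnW.
  by rewrite nth_rcons ib.
have hend : val om (size b) = s * 2 ^+ n.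
  rewrite (hom _ (leqnn _)) (nth_map 0); last by rewrite size_rcons.
  by rewrite nth_rcons ltnn eqxx.
have hb y : y \in b -> s * y != 2 ^+ n /\ s * y != - 2 ^+ n.
  by move=> /(exits_bound eb) hy; case: hs => ->; split; apply/eqP; lia.
apply/seteqP; split=> z /=.
  move=> [j <- hj]; have [jb|jb] := ltnP j (size b).
    by rewrite h //; apply/mapP; exists b`_j => //; exact: mem_nth.
  have [h1 h2] := hj _ jb; exfalso; move: h1 h2; rewrite hend.
  by case: hs => ->; rewrite ?mulN1r ?mul1r eqxx.
move=> /mapP[y yb ->]; have ib : (index y b < size b)%N by rewrite index_mem.
exists (index y b); first by rewrite h // nth_index.
by move=> i ii; rewrite h ?(leq_ltn_trans ii) //; apply/hb/mem_nth;
  exact: leq_ltn_trans ib.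
Qed.

Lemma cylinder_Rn n (s : int) b om : s = 1 \/ s = -1 -> exits n (2 ^+ n) b ->
  cylinder (map (fun y => s * y) (rcons b (2 ^+ n))) om -> Rn n om = size (undup b).
Proof.
move=> hs eb hom; rewrite /Rn (cylinder_visited hs eb hom).
rewrite -(card_fseq) /=;
  have -> : [set` [seq s * y | y <- b]] = [set` [fset x in [seq s * y | y <- b]]%fset].
  by apply/seteqP; split=> z /=; rewrite inE.
rewrite set_fsetK !card_fseq undup_map_inj ?size_map // => y z.
by case: hs => ->; lia.
Qed.

Lemma cylinder_Xn (R : realType) n (s : int) b om j : s = 1 \/ s = -1 ->
  exits n (2 ^+ n) b ->
  cylinder (map (fun y => s * y) (rcons b (2 ^+ n))) om ->
  (Xn R n om < j%:R / 2 ^+ n) = above j b.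
Proof.
move=> hs eb hom; rewrite /Xn (cylinder_Rn hs eb hom) (above_size_undup _ eb).
have p2 : 0 < 2 ^+ n :> R by rewrite exprn_gt0.
rewrite ltrBlDr -[X in _ + X](divff (lt0r_neq0 p2)) -mulrDl ltr_pM2r ?invr_gt0 //.
by rewrite -natrX -natrD ltr_nat addnC.
Qed.

Lemma sign_lt_neq (s s' v E : int) : s = 1 \/ s = -1 -> s' = 1 \/ s' = -1 ->
  - E < v < E -> s' * v = s * E -> False.
Proof. by case=> ->; case=> -> /andP[h1 h2] h3; lia. Qed.

(** The length of a stopped path is the first hitting time of {2^n, -2^n}, hence
is determined by any infinite extension; so distinct stopped paths have
disjoint cylinders. *)
Lemma exits_cylinder_inj n (s s' : int) b b' om : s = 1 \/ s = -1 ->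
  s' = 1 \/ s' = -1 ->
  exits n (2 ^+ n) b -> exits n (2 ^+ n) b' ->
  cylinder (map (fun y => s * y) (rcons b (2 ^+ n))) om ->
  cylinder (map (fun y => s' * y) (rcons b' (2 ^+ n))) om -> s = s' /\ b = b'.
Proof.
move=> hs hs' eb eb' H H'; have hom j : (j <= size b)%N ->
    val om j = [seq s * y | y <- rcons b (2 ^+ n)]`_j.
  by move=> hj; apply: H; rewrite /plen size_map size_rcons.
have hom' j : (j <= size b')%N -> val om j = [seq s' * y | y <- rcons b' (2 ^+ n)]`_j.
  by move=> hj; apply: H'; rewrite /plen size_map size_rcons.
have p2 : 0 < 2 ^+ n :> int by rewrite exprn_gt0.
pose f (c : seq int) i : int := c`_i.
have h (t : int) c i : (forall j, (j <= size c)%N ->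
  val om j = [seq t * y | y <- rcons c (2 ^+ n)]`_j) ->
   (i < size c)%N -> val om i = t * f c i.
  move=> hc ib; rewrite (hc _ (ltnW ib)) (nth_map 0);
    last by rewrite size_rcons ltnS ltnW.
  by rewrite nth_rcons ib.
have hend (t : int) c : (forall j, (j <= size c)%N ->
  val om j = [seq t * y | y <- rcons c (2 ^+ n)]`_j) ->
   val om (size c) = t * 2 ^+ n.
  move=> hc; rewrite (hc _ (leqnn _)) (nth_map 0); last by rewrite size_rcons.
  by rewrite nth_rcons ltnn eqxx.
have bd c i : exits n (2 ^+ n) c -> (i < size c)%N -> - 2 ^+ n < f c i < 2 ^+ n.
  by move=> ec ic; apply: (exits_bound ec); exact: mem_nth.
have sz : size b = size b'.
  have [lt|lt|//] := ltngtP (size b) (size b').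
    have := hend _ _ hom; rewrite (h _ _ _ hom') //.
    by move/(sign_lt_neq hs hs' (bd _ _ eb' lt)).
  have := hend _ _ hom'; rewrite (h _ _ _ hom) //.
  by move/(sign_lt_neq hs' hs (bd _ _ eb lt)).
have ss : s = s'.
  have := hend _ _ hom; rewrite sz (hend _ _ hom').
  by case: hs hs' => -> [] -> //; lia.
split=> //; apply: (@eq_from_nth _ 0) => // i ib.
rewrite -!/(f _ _); have := h _ _ _ hom ib; rewrite (h _ _ _ hom') ?ss -?sz //.
by case: hs' => ->; lia.
Qed.

(** * Expectations of functions of the rescaled range *)

(** The integral of a nonnegative function is a supremum over the simple
functions below it, hence monotone even without measurability; this avoids
proving that the range is a measurable function. *)
Lemma le_integral_ge0 d (T : measurableType d) (R : realType)
    (mu : {measure set T -> \bar R}) (f g : T -> \bar R) :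
  (forall x, (0 <= f x)%E) -> (forall x, (f x <= g x)%E) ->
  (\int[mu]_x f x <= \int[mu]_x g x)%E.
Proof.
move=> f0 fg; rewrite /integral; apply: leeB; apply: le_ereal_sup => _ [h /= hle <-];
  exists h => //= x; apply: (le_trans (hle x)); rewrite !patch_setT.
- by rewrite !funeposE !max_l //; exact: le_trans (f0 x) (fg x).
- by rewrite !funenegE !max_r // oppe_le0 //; exact: le_trans (f0 x) (fg x).
Qed.

Lemma measure_bigsetU_seq d (T : measurableType d) (R : realType) (I : choiceType)
    (mu : {measure set T -> \bar R}) (s : seq I) (F : I -> set T) :
  uniq s -> (forall i, i \in s -> measurable (F i)) ->
  (forall i j x, i \in s -> j \in s -> F i x -> F j x -> i = j) ->
  mu (\big[setU/set0]_(i <- s) F i) = (\sum_(i <- s) mu (F i))%E.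
Proof.
elim: s => [|i s IH] /=; first by rewrite !big_nil measure0.
move=> /andP[si us] mF dF; rewrite !big_cons measureU.
- congr (_ + _)%E; apply: IH => // [j js|j k x js ks]; first by apply: mF;
    rewrite inE js orbT.
  by apply: dF; rewrite inE ?js ?ks orbT.
- by apply: mF; rewrite mem_head.
- rewrite big_seq; apply: bigsetU_measurable => j js; apply: mF; by rewrite inE js orbT.
- rewrite -subset0 => x [Fi]; rewrite -bigcup_seq => -[j js Fj].
  have ij : i = j by apply: dF Fi Fj; rewrite inE ?eqxx // js orbT.
  by move: si; rewrite ij js.
Qed.

Lemma exits_opp n b : exits n (2 ^+ n) b -> exits n (- 2 ^+ n) [seq - y | y <- b].
Proof.
case=> sb b0 pb ib; split; first by rewrite size_map.
- by rewrite (nth_map 0) // b0 oppr0.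
- rewrite -(map_rcons -%R) behead_map -[X in path _ X]oppr0 path_map.
  by rewrite (eq_path (e' := unit_step)) // => x y; rewrite /unit_step /= -opprD normrN.
- by move=> y /mapP[z zb ->]; rewrite rpredN => /(ib _ zb) ->; rewrite oppr0.
Qed.

Section Law.
Variables (R : realType) (u : R) (P : probability Winf_mt R).
Hypotheses (hu : 0 < u) (hP : is_Pu u P).

Definition signed_cylinder n (sb : int * seq int) : set Winf_mt :=
  cylinder [seq sb.1 * y | y <- rcons sb.2 (2 ^+ n)].

Lemma signed_cylinder_prob n (s : int) b : (0 < n)%N -> (s = 1 \/ s = -1) ->
  exits n (2 ^+ n) b ->
  measurable (signed_cylinder n (s, b)) /\ P (signed_cylinder n (s,
    b)) = (2^-1 * path_prob u n b)%:E.
Proof.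
move=> n0 hs eb; rewrite /signed_cylinder /= /path_prob gtn_eqF //.
have pn0 : 2 ^+ n != 0 :> int by apply: expf_neq0.
case: hs => ->.
  have -> : [seq 1 * y | y <- rcons b (2 ^+ n)] = rcons b (2 ^+ n).
    by rewrite -[RHS]map_id; apply: eq_map => y; rewrite mul1r.
  have hw := exits_Wplus eb; split; last by have [->] := hP (rcons b (2 ^+ n)) n0.
  apply: sub_sigma_algebra; exists (rcons b (2 ^+ n)) => //.
  by case/and3P: hw.
have -> : [seq -1 * y | y <- rcons b (2 ^+ n)] = rcons [seq - y | y <- b] (- 2 ^+ n).
  by rewrite -(map_rcons -%R); apply: eq_map => y; rewrite mulN1r.
have [||hW hT] := (@exitsP n (- 2 ^+ n) [seq - y | y <- b] _ _).1 (exits_opp eb).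
- by rewrite oppr_eq0.
- by rewrite rpredN dvdzz.
have hw : Wminus n (rcons [seq - y | y <- b] (- 2 ^+ n)).
  by rewrite /Wminus hW hT /plen size_rcons nth_rcons ltnn !eqxx.
split.
  by apply: sub_sigma_algebra; exists (rcons [seq - y | y <- b] (- 2 ^+ n)).
have [_ ->//] := hP (rcons [seq - y | y <- b] (- 2 ^+ n)) n0.
rewrite /Pminus map_rcons -map_comp opprK; congr (_ * Pplus _ _ (rcons _ _))%:E.
by rewrite -[RHS]map_id; apply: eq_map => y /=; rewrite opprK.
Qed.

(* The stopped paths whose minimum m satisfies m > -A or m <= -B, that is
   R_n / 2^n - 1 outside [A / 2^n, B / 2^n[. *)
Let bad A B (b : seq int) := above A b || ~~ above B b.

Let L n K A B := [seq (s, b) | s <- [:: 1;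
  -1 : int], b <- [seq b <- exit_bodies n K | bad A B b]].

Let LP n K A B sb : sb \in L n K A B ->
  [/\ sb.1 = 1 \/ sb.1 = -1, exits n (2 ^+ n) sb.2 & bad A B sb.2].
Proof.
move=> /allpairsP[[s b] /= [hs + ->]];
  rewrite mem_filter => /andP[hb /exit_bodies_exits eb].
by split=> //=; move: hs; rewrite !inE => /orP[]/eqP->; [left|right].
Qed.

Lemma bad_prob n K A B : (0 < n)%N -> (A <= B)%N ->
  measurable (\big[setU/set0]_(sb <- L n K A B) signed_cylinder n sb) /\
  P (\big[setU/set0]_(sb <- L n K A B) signed_cylinder n sb) =
    (above_sum u n K A + (above_sum u n K (2 ^ n) - above_sum u n K B))%:E.
Proof.
move=> n0 AB; split.
  rewrite big_seq; apply: bigsetU_measurable => -[s b] /LP[hs eb _].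
  by have [] := signed_cylinder_prob n0 hs eb.
rewrite measure_bigsetU_seq.
- rewrite big_seq (eq_bigr (fun sb => (2^-1 * path_prob u n sb.2)%:E)) =>
    [|[s b] /LP[hs eb _]]; last first.
    by case: (signed_cylinder_prob n0 hs eb) => _ /= ->.
  rewrite -big_seq sumEFin; congr EFin.
  rewrite big_allpairs_dep /= !big_cons big_nil addr0 -!mulr_sumr.
  have -> z : 2^-1 * z + 2^-1 * z = z :> R by field.
  rewrite big_filter big_mkcond /above_sum -sumrB -big_split /= !big_seq.
  apply: eq_bigr => b /exit_bodies_exits eb; rewrite (above_full eb) /bad.
  case hA: (above A b); case hB: (above B b) => /=; rewrite ?mul0r ?mul1r; try ring.
  suff : above B b by rewrite hB.
  apply/allP => y /(allP hA) /=; apply: le_lt_trans; lia.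
- apply: allpairs_uniq => //; first by rewrite filter_uniq // exit_bodies_uniq.
  by move=> [? ?] [? ?].
- move=> [s b] /LP[hs eb _]; by have [] := signed_cylinder_prob n0 hs eb.
- move=> [s b] [s' b'] om /LP[hs eb _] /LP[hs' eb' _] h1 h2.
  by case: (exits_cylinder_inj hs hs' eb eb' h1 h2) => /= -> ->.
Qed.

(** Only the probability of finitely many explicit cylinders is known, so the
event that the range falls in a window is bounded from above through its
complement: the cylinders of paths whose range is outside have probability
tending to range_cdf A + 1 - range_cdf B.  For A = 0 the left constraint is
void, since the rescaled range is nonnegative. *)
Lemma expectation_Xn_le n A B (f : R -> R) : (0 < n)%N -> (A <= B)%N ->
  (forall t, 0 <= f t <= 1) ->
  (forall t, (0 < A)%N /\ t < A%:R / 2 ^+ n \/ B%:R / 2 ^+ n <= t -> f t = 0) ->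
  ('E_P[f \o @Xn R n] <= (range_cdf (xu u) n B - range_cdf (xu u) n A)%:E)%E.
Proof.
move=> n0 AB f01 f0.
have x0 := xu_gt0 hu; have x1 := xu_lt1 hu.
have h K : ('E_P[f \o @Xn R n] <= (1 - (above_sum u n K A + (above_sum u n K (2 ^ n) -
  above_sum u n K B)))%:E)%E.
  have [mU PU] := bad_prob K n0 AB; set U := (X in measurable X) in mU PU.
  rewrite EFinB -PU -probability_setC // unlock.
  rewrite -[X in (_ <= P X)%E]setIT -integral_indic //; last exact: measurableC.
  apply: le_integral_ge0 => om /=; first by rewrite lee_fin;
    case/andP: (f01 (Xn R n om)).
  rewrite lee_fin indicE; case: (boolP (om \in ~` U)) => [_|].
    by case/andP: (f01 (Xn R n om)).
  rewrite in_setC negbK inE /U -bigcup_seq => -[[s b] /= /LP[/= hs eb hb] hom].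
  rewrite f0 //; have hX j := cylinder_Xn R j hs eb hom.
  move: hb; rewrite /bad => /orP[hA|]; last by rewrite -hX -leNgt; right.
  left; rewrite hX; split=> //.
  have [sb b0 _ _] := eb; have := allP hA _ (mem_nth 0 sb); rewrite b0 /=; lia.
have c : (1 - (above_sum u n K A + (above_sum u n K (2 ^ n) - above_sum u n K B))) @[K
  --> \oo] -->
   1 - (range_cdf (xu u) n A + (range_cdf (xu u) n (2 ^ n) - range_cdf (xu u) n B)).
  apply: cvgB; first exact: cvg_cst.
  by apply: cvgD; [|apply: cvgB]; exact: above_sum_cvg.
rewrite (_ : range_cdf _ _ _ - _ = 1 - (range_cdf (xu u) n A + (range_cdf (xu u) n (2 ^
  n) - range_cdf (xu u) n B))); last first.
  by rewrite [range_cdf _ n (2 ^ n)]range_cdf_full ?x0 //; ring.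
have cE : (1 - (above_sum u n K A + (above_sum u n K (2 ^ n) - above_sum u n K B)))%:E
  @[K --> \oo] -->
   (1 - (range_cdf (xu u) n A + (range_cdf (xu u) n (2 ^ n) - range_cdf (xu u) n
     B)))%:E.
  by apply: cvg_EFin => //; near=> K.
by apply: (cvge_to_ge cE); near=> K; exact: h.
Unshelve. all: by end_near.
Qed.

End Law.

(** * The limit law of dyadic intervals *)

Section Tent.
Variables (R : realType) (a b e : R).
Hypotheses (e0 : 0 < e).

Definition tent : R -> R :=
  (fun=> 0) \max (((fun=> 1) \min (fun t => 1 - (a - t) / e)) \min (fun t =>
    1 - (t - b) / e)).

Lemma tent_continuous : continuous tent.
Proof.
move=> t; apply: continuous_max; first exact: cst_continuous.
apply: continuous_min; first apply: continuous_min.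
- exact: cst_continuous.
- apply: continuousB; first exact: cst_continuous.
  apply: continuousM; last exact: cst_continuous.
  by apply: continuousB => //; exact: cst_continuous.
- apply: continuousB; first exact: cst_continuous.
  apply: continuousM; last exact: cst_continuous.
  by apply: continuousB => //; exact: cst_continuous.
Qed.

Lemma tent_bound t : 0 <= tent t <= 1.
Proof. by rewrite /tent /= le_max lexx ge_max ler01 !ge_min lexx. Qed.

Lemma tent1 t : a <= t <= b -> tent t = 1.
Proof.
move=> /andP[at_ tb].
have h1 : (a - t) / e <= 0 by rewrite pmulr_lle0 ?invr_gt0 // subr_le0.
have h2 : (t - b) / e <= 0 by rewrite pmulr_lle0 ?invr_gt0 // subr_le0.
rewrite /tent /= [Num.min 1 _]min_l; last by lra.
by rewrite min_l ?max_r //; lra.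
Qed.

Lemma tent0 t : t < a - e \/ b + e <= t -> tent t = 0.
Proof.
move=> h; rewrite /tent /= max_l // !ge_min.
case: h => h.
  have : 1 <= (a - t) / e by rewrite ler_pdivlMr // mul1r; lra.
  by move=> h1; rewrite (_ : 1 - (a - t) / e <= 0) ?orbT //; lra.
have : 1 <= (t - b) / e by rewrite ler_pdivlMr // mul1r; lra.
by move=> h1; rewrite (_ : 1 - (t - b) / e <= 0) ?orbT //; lra.
Qed.

End Tent.

Definition dyad (R : realType) (l j : nat) : set R :=
  [set` `[j%:R / 2 ^+ l, j.+1%:R / 2 ^+ l]].
Arguments dyad R l j : clear implicits.

Section Limit.
Variables (R : realType) (u : R).
Variables (P : probability Winf_mt R) (Pt : probability (measurableTypeR R) R).
Hypotheses (hu : 0 < u) (hP : is_Pu u P) (hPt : converges_weakly P (@Xn R) Pt).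

(** A tent equal to 1 on the dyadic interval and supported in its neighbourhood
of width 2^-(l+M) has, at every scale n >= l + M, an expectation that does not
depend on n by [range_cdf_scale]. *)
Lemma limit_dyad_le l M j : (0 < l + M)%N ->
  (Pt (dyad R l j) <= (range_cdf (xu u) (l + M) (j.+1 * 2 ^ M).+1 -
                       range_cdf (xu u) (l + M) (j * 2 ^ M).-1)%:E)%E.
Proof.
move=> lM0; set A := (j * 2 ^ M).-1; set B := (j.+1 * 2 ^ M).+1.
have x0 := xu_gt0 hu; have x1 := xu_lt1 hu.
have x01 : 0 < xu u < 1 by rewrite x0 x1.
have AB : (A <= B)%N.
  by rewrite /A /B; apply: (leq_trans (leq_pred _)); rewrite mulSn; lia.
have p2 n : 0 < 2 ^+ n :> R by rewrite exprn_gt0.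
pose f := tent (j%:R / 2 ^+ l) (j.+1%:R / 2 ^+ l) (2 ^- (l + M) : R).
have e0 : 0 < 2 ^- (l + M) :> R by rewrite invr_gt0.
have hE n : (l + M <= n)%N ->
    ('E_P[f \o @Xn R n] <= (range_cdf (xu u) (l + M) B - range_cdf (xu u) (l + M)
      A)%:E)%E.
  move=> hn; rewrite -(range_cdf_scale x01 _ (n - (l + M)) A) -(range_cdf_scale x01 _
    (n - (l + M)) B).
  rewrite subnKC //.
  have sc i : (i * 2 ^ (n - (l + M)))%:R / 2 ^+ n = i%:R / 2 ^+ (l + M) :> R.
    rewrite -[in 2 ^+ n](subnKC hn) natrM natrX [2 ^+ (_ + (_ - _))]exprD.
    rewrite invfM mulrACA [_ / 2 ^+ (n - _)](_ : _ = 1) ?mulr1 //.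
    by rewrite divff // lt0r_neq0.
  apply: (expectation_Xn_le hu hP) => //.
  - exact: leq_trans hn.
  - by rewrite leq_mul2r AB orbT.
  - by move=> t; exact: tent_bound.
  - move=> t; rewrite !sc => ht; apply: tent0 => //.
    have s2 : 2 ^- l = (2 ^ M)%:R * 2 ^- (l + M) :> R.
      by rewrite natrX exprD invfM mulrCA divff ?mulr1 // lt0r_neq0.
    case: ht => [[hA ht]|ht]; [left|right].
      have jM : (0 < j * 2 ^ M)%N.
        by move: hA; rewrite muln_gt0 /A; case: (j * _)%N => // k _; rewrite ltn0.
      apply: (lt_le_trans ht); rewrite s2 mulrA -natrM.
      by rewrite -[X in _ - X]mul1r -mulrBl /A -subn1 natrB.
    apply: le_trans ht; rewrite s2 mulrA -natrM.
    by rewrite -[X in _ + X]mul1r -mulrDl natr1.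
have hI : (\int[Pt]_t (f t)%:E <= (range_cdf (xu u) (l + M) B - range_cdf (xu u) (l +
  M) A)%:E)%E.
  have := hPt (@tent_continuous R (j%:R / 2 ^+ l) (j.+1%:R / 2 ^+ l) (2 ^- (l + M))).
  have bd : exists M0 : R, forall x, `|f x| <= M0.
    by exists 1 => t; have /andP[h0 h1] :=
      tent_bound (j%:R / 2 ^+ l) (j.+1%:R / 2 ^+ l) (2 ^- (l + M)) t; rewrite ger0_norm.
  move=> /(_ bd) hc; apply: (cvge_to_le hc).
  by exists (l + M)%N => // n /= hn; exact: hE.
apply: le_trans hI.
rewrite -[X in (Pt X <= _)%E]setIT -integral_indic //; last exact: measurable_itv.
apply: le_integral_ge0 => t /=; first by rewrite lee_fin.
rewrite lee_fin indicE; case: (boolP (t \in dyad R l j)) => ht.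
  by rewrite /f tent1 //; move: ht; rewrite inE /dyad /= in_itv.
by case/andP: (tent_bound (j%:R / 2 ^+ l) (j.+1%:R / 2 ^+ l) (2 ^- (l + M)) t).
Qed.

End Limit.

(** * Multiplicative cascades and Moebius maps *)

(** The product, along the n binary digits of j starting with the leading one, of
weights al (digit 0) or be (digit 1) taken at a state that moves by t0 or t1
after each digit.  Peeling off the leading digit lets the state vary in
inductions on n. *)
Section Cascade.
Variables (R : realType) (t0 t1 : R -> R).
Implicit Types (al be : R -> R) (w : R).

Fixpoint cascade al be w n j : R :=
  if n is n'.+1 then
    if (j < 2 ^ n')%N then al w * cascade al be (t0 w) n' j
    else be w * cascade al be (t1 w) n' (j - 2 ^ n')%N
  else 1.

Variable inv : R -> Prop.
Hypotheses (inv0 : forall w, inv w -> inv (t0 w)) (inv1 : forall w, inv w ->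
  inv (t1 w)).

Lemma cascade_gt0 al be w n j : (forall w, inv w -> 0 < al w) ->
  (forall w, inv w -> 0 < be w) -> inv w -> 0 < cascade al be w n j.
Proof.
move=> a0 b0; elim: n w j => [|n IH] w j hw /=; first exact: ltr01.
by case: ifP => _; rewrite mulr_gt0 ?a0 ?b0 ?IH //; [apply: inv0|apply: inv1].
Qed.

Lemma sum_cascade al be w n : \sum_(0 <= j < 2 ^ n.+1) cascade al be w n.+1 j =
  al w * (\sum_(0 <= j < 2 ^ n) cascade al be (t0 w) n j) +
  be w * (\sum_(0 <= j < 2 ^ n) cascade al be (t1 w) n j).
Proof.
rewrite expnS mul2n -addnn (big_cat_nat _ (n := 2 ^ n)) ?leq_addr //=; congr (_ + _).
  by rewrite mulr_sumr !big_nat; apply: eq_bigr => j /andP[_ ->].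
rewrite -{1}[(2 ^ n)%N]add0n big_addn addnK mulr_sumr; apply: eq_bigr => j _.
by rewrite ltnNge leq_addl /= addnK.
Qed.

Lemma sum_cascade_le al be w n rho : (forall w, inv w -> 0 <= al w) ->
  (forall w, inv w -> 0 <= be w) -> (forall w, inv w -> al w + be w <= rho) ->
  inv w -> \sum_(0 <= j < 2 ^ n) cascade al be w n j <= rho ^+ n.
Proof.
move=> a0 b0 h; elim: n w => [|n IH] w hw; first by rewrite expn0 big_nat1.
rewrite sum_cascade exprS; apply: (@le_trans _ _ ((al w + be w) * rho ^+ n)).
  by rewrite mulrDl lerD // ler_wpM2l ?a0 ?b0 ?IH //; [apply: inv0|apply: inv1].
rewrite ler_wpM2r ?h // exprn_ge0 //.
by apply: le_trans (h _ hw); rewrite addr_ge0 ?a0 ?b0.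
Qed.

Lemma cascade_le al be w n j rho : (forall w, inv w -> 0 < al w <= rho) ->
  (forall w, inv w -> 0 < be w <= rho) -> inv w -> cascade al be w n j <= rho ^+ n.
Proof.
move=> a0 b0; elim: n w j => [|n IH] w j hw //=.
have hc u k : inv u -> 0 <= cascade al be u n k.
  by move=> hu; rewrite ltW // cascade_gt0 // => v hv;
    [case/andP: (a0 _ hv)|case/andP: (b0 _ hv)].
have /andP[a1 a2] := a0 _ hw; have /andP[b1 b2] := b0 _ hw.
rewrite exprS; case: ifP => _; apply: ler_pM; rewrite ?(ltW a1) ?(ltW b1) ?hc //;
  by [apply: inv0|apply: inv1|apply: IH; apply: inv0|apply: IH; apply: inv1].
Qed.

Lemma cascade_mul al be al' be' w n j :
  cascade (fun w => al w * al' w) (fun w => be w * be' w) w n j =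
  cascade al be w n j * cascade al' be' w n j.
Proof.
elim: n w j => [|n IH] w j /=; first by rewrite mulr1.
by case: ifP => _; rewrite IH mulrACA.
Qed.

Lemma cascade_scale al be w n j k :
  cascade (fun w => al w * k) (fun w => be w * k) w n j = cascade al be w n j * k ^+ n.
Proof.
elim: n w j => [|n IH] w j /=; first by rewrite mulr1.
by case: ifP => _; rewrite IH exprS mulrACA.
Qed.

Lemma cascade_powR al be w n j s : (forall w, inv w -> 0 < al w) ->
  (forall w, inv w -> 0 < be w) -> inv w ->
  cascade (fun w => al w `^ s) (fun w => be w `^ s) w n j = cascade al be w n j `^ s.
Proof.
move=> a0 b0; elim: n w j => [|n IH] w j hw /=; first by rewrite powR1.
by case: ifP => _; rewrite powRM ?IH ?(ltW (a0 _ _)) ?(ltW (b0 _ _)) ?ltW ?cascade_gt0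
  //;
  try apply: inv0; try apply: inv1.
Qed.

(** Markov inequality for psi ^ s, where psi is a second cascade driven by the
same states: the bound is again a cascade sum. *)
Lemma cascade_chernoff p0 p1 al be w n s (bad : pred nat) :
  (forall w, inv w -> 0 < p0 w) -> (forall w, inv w -> 0 < p1 w) ->
  (forall w, inv w -> 0 < al w) -> (forall w, inv w -> 0 < be w) -> inv w ->
  (forall j, bad j -> 1 <= cascade al be w n j `^ s) ->
  \sum_(0 <= j < 2 ^ n | bad j) cascade p0 p1 w n j <=
  \sum_(0 <= j < 2 ^ n) cascade (fun w => p0 w * al w `^ s) (fun w =>
    p1 w * be w `^ s) w n j.
Proof.
move=> hp0 hp1 ha hb hw hbad; rewrite big_mkcond /=; apply: ler_sum => j _.
rewrite cascade_mul cascade_powR //; have h := ltW (cascade_gt0 n j hp0 hp1 hw).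
case: ifP => [/hbad hj|_]; first by rewrite ler_peMr.
by rewrite mulr_ge0 // powR_ge0.
Qed.

End Cascade.

Section Moebius.
Variables (R : realType) (x : R).
Hypothesis x01 : 0 < x < 1.
Let c := 2 * x / (1 + x).

(** Conditional probabilities of the next digit and moves of the state.  With
T w z = (1 + w) z / (1 + w z), the first branch f of the distribution function
satisfies T w (f z) = digit0 w * T (state0 w) z, and similarly for the second
one up to the translation by digit0 w. *)
Definition digit0 (w : R) := c * (1 + w) / (1 + c * w).
Definition digit1 (w : R) := (1 - c) / (1 + c * w).
Definition state0 (w : R) := x * w - (1 - x) / 2.
Definition state1 (w : R) := - (1 - c) / (1 + c * w).

Lemma c_eq : c * (1 + x) = 2 * x.
Proof. by case/andP: x01 => h0 h1; rewrite /c divfK //; lra. Qed.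

Lemma c_itv : 0 < c < 1.
Proof.
case/andP: x01 => h0 h1; rewrite /c divr_gt0 /= ?ltr_pdivrMr; lra.
Qed.

Lemma digit_sum w : -1 < w <= 0 -> digit0 w + digit1 w = 1.
Proof.
move=> /andP[w1 w0]; have /andP[c0 c1] := c_itv.
by rewrite /digit0 /digit1 -mulrDl (_ : c * (1 + w) + (1 - c) = 1 + c * w) ?divff //;
  nra.
Qed.

Lemma state0_itv w : -1 < w <= 0 -> -1 < state0 w <= 0.
Proof. by move=> /andP[w1 w0]; case/andP: x01 => h0 h1; rewrite /state0; nra. Qed.

Lemma state1_itv w : -1 < w <= 0 -> -1 < state1 w <= 0.
Proof.
move=> /andP[w1 w0]; have /andP[c0 c1] := c_itv; have d0 : 0 < 1 + c * w by nra.
rewrite /state1 mulNr oppr_le0 ltrNl opprK ltr_pdivrMr // divr_ge0 ?(ltW d0) //; nra.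
Qed.

Let T (w z : R) : R := (1 + w) * z / (1 + w * z).

Lemma moebius_low w z : -1 < w <= 0 -> 0 <= z <= 1 ->
  T w (x * z / (1 - (1 - x) / 2 * z)) = digit0 w * T (state0 w) z.
Proof.
move=> /andP[w1 w0] /andP[z0 z1]; case/andP: x01 => h0 h1.
have d1 : 0 < 1 - (1 - x) / 2 * z by nra.
have d2 : 0 < 1 + state0 w * z.
  have /andP[? ?] : -1 < state0 w <= 0 by apply: state0_itv; rewrite w1.
  nra.
have /andP[c0 c1] := c_itv; have d3 : 0 < 1 + c * w by nra.
have d4 : 1 + state0 w * z = (1 - (1 - x) / 2 * z) + w * (x * z) by rewrite /state0;
  ring.
rewrite /T /digit0.
have -> : 1 + w * (x * z / (1 - (1 - x) / 2 * z)) = (1 + state0 w * z) / (1 - (1 - x) /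
  2 * z).
  by rewrite d4; field; lra.
have -> : 1 + state0 w = (1 + x) / 2 * (1 + c * w).
  by have := c_eq; rewrite /state0; nra.
have cE : c * ((1 + x) / 2) = x by have := c_eq; lra.
transitivity ((1 + w) * (c * ((1 + x) / 2)) * z / (1 + state0 w * z)).
  rewrite cE; field; by rewrite !lt0r_neq0 //; lra.
by field; rewrite !lt0r_neq0.
Qed.

Lemma moebius_high w z : -1 < w <= 0 -> 0 <= z <= 1 ->
  T w (x / (1 - (1 - x) / 2 * (1 + z))) = digit0 w + digit1 w * T (state1 w) z.
Proof.
move=> /andP[w1 w0] /andP[z0 z1]; case/andP: x01 => h0 h1.
have /andP[c0 c1] := c_itv; have d3 : 0 < 1 + c * w by nra.
have d : 0 < 1 + c * w - (1 - c) * z by nra.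
have d1 : 0 < 1 - (1 - c) * z by nra.
have e1 : x / (1 - (1 - x) / 2 * (1 + z)) = c / (1 - (1 - c) * z).
  have ee : 1 - (1 - x) / 2 * (1 + z) = (1 + x) / 2 * (1 - (1 - c) * z).
    by have := c_eq; nra.
  have xE : x = (1 + x) / 2 * c by have := c_eq; lra.
  by rewrite ee {1}xE -mulf_div divff ?mul1r //; lra.
have e2 : T w (c / (1 - (1 - c) * z)) = c * (1 + w) / (1 + c * w - (1 - c) * z).
  by rewrite /T; field; rewrite !lt0r_neq0 //; lra.
have e3 : T (state1 w) z = c * (1 + w) * z / (1 + c * w - (1 - c) * z).
  rewrite /T /state1; field; rewrite !lt0r_neq0 //; lra.
rewrite e1 e2 e3 /digit0 /digit1; field; rewrite !lt0r_neq0 //; lra.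
Qed.

(** The increments of T w (range_cdf n _) satisfy the recursion of the cascade.
At w = 0 the map T is the identity, so there the cascade computes the mass of
dyadic intervals. *)
Lemma cascade_range_cdf w n j : -1 < w <= 0 -> (j < 2 ^ n)%N ->
  cascade state0 state1 digit0 digit1 w n j = T w (range_cdf x n j.+1) - T w (range_cdf
    x n j).
Proof.
elim: n w j => [|n IH] w j hw.
  case: j => // _; rewrite /T /= mulr0 mul0r subr0 !mulr1 divff //.
  by case/andP: hw => h1 h0; lra.
rewrite expnS mul2n -addnn => hj; rewrite [cascade _ _ _ _ _ _ _]/=.
have Tl z : (z <= 2 ^ n)%N ->
  T w (range_cdf x n.+1 z) = digit0 w * T (state0 w) (range_cdf x n z).
  by move=> hz; rewrite range_cdfS hz moebius_low // range_cdf_itv.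
have Th z : (2 ^ n <= z)%N ->
  T w (range_cdf x n.+1 z) = digit0 w + digit1 w * T (state1 w) (range_cdf x n (z - 2 ^
    n)).
  rewrite leq_eqVlt => /orP[/eqP <-|hz].
    rewrite Tl // subnn range_cdf0 range_cdf_full //
      /T mulr0 mul0r mulr0 addr0 !mulr1 divff ?mulr1 //.
    by have /andP[h1 h0] := state0_itv hw; lra.
  by rewrite range_cdfS leqNgt hz /= moebius_high // range_cdf_itv.
case: ltnP => h; first by rewrite IH ?state0_itv // !Tl ?(ltnW h) // -mulrBr.
rewrite !Th ?(leqW h) // subSn // IH ?state1_itv //; last by rewrite ltn_subLR.
by ring.
Qed.

End Moebius.

(** * The conditional digit probabilities *)

Section Bounds.
Variables (R : realType) (x : R).
Hypothesis x01 : 0 < x < 1.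
Let c := 2 * x / (1 + x).

Definition state_itv (k w : R) : Prop := - k <= w <= 0.

Lemma state_itv0 k w : 1 / 2 <= k < 1 -> state_itv k w -> state_itv k (state0 x w).
Proof.
move=> /andP[k0 k1] /andP[w1 w0]; case/andP: x01 => h0 h1.
by rewrite /state_itv /state0; apply/andP; split; nra.
Qed.

Lemma state_itv1 k w : 1 / 2 <= k < 1 -> 1 - c <= c * k -> state_itv k w ->
  state_itv k (state1 x w).
Proof.
move=> /andP[k0 k1] hk /andP[w1 w0]; have /andP[c0 c1] := c_itv x01.
have d : 0 < 1 + c * w by rewrite /c in hk *; nra.
rewrite /state_itv /state1 -/c mulNr oppr_le0 lerN2 ler_pdivrMr //
  divr_ge0 ?(ltW d) ?subr_ge0 ?(ltW c1) // andbT.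
by rewrite -/c in c0 c1; nra.
Qed.

(** -1/2 and -(1 - c) / c are the fixed points of the two state maps that bound
the states from below; the second one is greater than -1 exactly when
x > 1/3. *)
Lemma kappa_exists : 1 / 3 < x -> exists k, 1 / 2 <= k < 1 /\ 1 - c <= c * k.
Proof.
move=> x3; have /andP[c0 c1] := c_itv x01; rewrite -/c in c0 c1.
have ce := c_eq x01; rewrite -/c in ce.
have cr : (1 - c) / c < 1 by rewrite ltr_pdivrMr // mul1r; case/andP: x01 => ? ?; nra.
exists (Num.max (1 / 2) ((1 - c) / c)); split.
  by rewrite le_max lexx /= gt_max cr andbT; lra.
by rewrite mulrC -ler_pdivrMr // le_max lexx orbT.
Qed.

Section Kappa.
Variable k : R.
Hypotheses (k01 : 1 / 2 <= k < 1) (hk : 1 - c <= c * k).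

Lemma den_bound w : state_itv k w -> 0 < 1 - c * k <= 1 + c * w /\ 1 + c * w <= 1.
Proof.
case/andP: k01 => k0 k1 /andP[w1 w0]; have /andP[c0 c1] := c_itv x01.
rewrite -/c in c0 c1; split; last nra.
by apply/andP; split; nra.
Qed.

Lemma digit0_itv w : state_itv k w -> c * (1 - k) <= digit0 x w <= c.
Proof.
move=> hw; have [/andP[d1 d2] d3] := den_bound hw;
  have d : 0 < 1 + c * w by exact: lt_le_trans d2.
case/andP: k01 => k0 k1; case/andP: hw => w1 w0; have /andP[c0 c1] := c_itv x01;
  rewrite -/c in c0 c1.
rewrite /digit0 -/c ler_pdivlMr // ler_pdivrMr //; apply/andP; split; last nra.
have h : c * (1 - k) <= c * (1 + w) by rewrite ler_pM2l //; lra.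
apply: le_trans h; rewrite ler_piMr // mulr_ge0; lra.
Qed.

Lemma digit0_gt0 w : state_itv k w -> 0 < digit0 x w.
Proof.
move=> /digit0_itv/andP[+ _]; apply: lt_le_trans; have /andP[c0 _] := c_itv x01.
by case/andP: k01 => k0 k1; rewrite mulr_gt0 //; lra.
Qed.

Lemma digit1_gt0 w : state_itv k w -> 0 < digit1 x w.
Proof.
move=> /den_bound[/andP[d1 d2] _]; have /andP[c0 c1] := c_itv x01.
by rewrite /digit1 -/c divr_gt0 ?subr_gt0 // (lt_le_trans d1).
Qed.

Lemma digit_sum_eq1 w : state_itv k w -> digit0 x w + digit1 x w = 1.
Proof.
move=> /andP[w1 w0]; apply: digit_sum => //; case/andP: k01 => k0 k1.
by rewrite w0 andbT; lra.
Qed.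

Let rho := Num.max c (1 - c * (1 - k)).

Lemma contraction_itv : 0 < rho < 1.
Proof.
have /andP[c0 c1] := c_itv x01; rewrite -/c in c0 c1; case/andP: k01 => k0 k1.
rewrite /rho lt_max c0 gt_max c1 /=.
by rewrite gtrBl mulr_gt0 //; lra.
Qed.

Lemma cascade_digit_le w n j : state_itv k w ->
  cascade (state0 x) (state1 x) (digit0 x) (digit1 x) w n j <= rho ^+ n.
Proof.
apply: (cascade_le (inv := state_itv k)).
- by move=> ? ?; apply: state_itv0.
- by move=> ? ?; apply: state_itv1.
- by move=> v hv; rewrite digit0_gt0 // /rho le_max; case/andP: (digit0_itv hv) => _ ->.
- move=> v hv; rewrite digit1_gt0 //
    /rho le_max -[digit1 x v](addKr (digit0 x v)) digit_sum_eq1 //.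
  by rewrite [X in _ || X](_ : _ = true) ?orbT // addrC lerD2l lerN2;
    case/andP: (digit0_itv hv).
Qed.

Lemma range_cdf_step n j : (j < 2 ^ n)%N ->
  range_cdf x n j.+1 - range_cdf x n j = cascade (state0 x) (state1 x) (digit0 x)
    (digit1 x) 0 n j.
Proof.
move=> hj; rewrite cascade_range_cdf //; last by rewrite lexx ltrN10.
by rewrite addr0 !mul1r !mul0r addr0 !divr1.
Qed.

Lemma state_itv_0 : state_itv k 0.
Proof. by case/andP: k01 => k0 k1; rewrite /state_itv lexx andbT; lra. Qed.

Lemma range_cdf_step_le n j : range_cdf x n j.+1 - range_cdf x n j <= rho ^+ n.
Proof.
have [hj|hj] := ltnP j (2 ^ n); first by rewrite range_cdf_step // cascade_digit_le //;
  exact: state_itv_0.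
rewrite !range_cdf_full ?subrr ?(leqW hj) // exprn_ge0 // ltW //.
by case/andP: contraction_itv.
Qed.

End Kappa.

(** With e = p - 1/2, the square of the left side is 1 + 2 sqrt(1/4 - e^2), at
most 2 - 2 e^2. *)
Lemma sqrt_sum (p q : R) : 0 <= p -> 0 <= q -> p + q = 1 ->
  Num.sqrt p + Num.sqrt q <= Num.sqrt 2 * (1 - (p - 1 / 2) ^+ 2 / 2).
Proof.
move=> p0 q0 pq1; set e := p - 1 / 2.
have e4 : e ^+ 2 <= 1 / 4 by rewrite /e; nra.
have h0 : 0 <= 1 - e ^+ 2 / 2 by lra.
have sp : Num.sqrt p * Num.sqrt q <= 1 / 2 - e ^+ 2.
  rewrite -sqrtrM // -[X in _ <= X]ger0_norm; last by lra.
  rewrite -sqrtr_sqr ler_wsqrtr // (_ : p * q = 1 / 4 - e ^+ 2).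
    have := sqr_ge0 (e ^+ 2); nra.
  by rewrite (_ : q = 1 - p) /e; [field|lra].
rewrite -(@ler_pXn2r _ 2) // ?nnegrE ?addr_ge0 ?mulr_ge0 ?sqrtr_ge0 //.
rewrite exprMn sqr_sqrtr // sqrrD !sqr_sqrtr //.
have := sqr_ge0 (e ^+ 2 / 2); nra.
Qed.

(** The digits are fair at w = (1 - 3 x) / (2 x) only. *)
Lemma digit0_half w : -1 < w <= 0 ->
  (c / 2 * (w - (1 - 3 * x) / (2 * x))) ^+ 2 <= (digit0 x w - 1 / 2) ^+ 2.
Proof.
move=> /andP[w1 w0]; have /andP[c0 c1] := c_itv x01; rewrite -/c in c0 c1;
  case/andP: x01 => h0 h1.
have d : 0 < 1 + c * w by nra.
set ws := (1 - 3 * x) / (2 * x).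
have cws : c * ws = 1 - 2 * c.
  rewrite /c /ws; field; lra.
have -> : digit0 x w - 1 / 2 = (c / 2 * (w - ws)) / (1 + c * w).
  rewrite /digit0 -/c (_ : c / 2 * (w - ws) = (c * w - (1 - 2 * c)) / 2);
    last by rewrite -cws; field.
  by field; lra.
rewrite expr_div_n ler_pdivlMr ?exprn_gt0 // ler_piMr ?sqr_ge0 //.
by rewrite expr_le1 ?(ltW d) //; nra.
Qed.

(** One step yields at most sqrt 2, with a defect quadratic in the distance from
w to the fair state ws.  The map state0 moves ws by del, which is nonzero for
x <> 1/2, so w and state0 w are not both close to ws; and the digit 0 leading
to state0 w keeps a probability bounded below. *)
Lemma two_step_sqrt_sum k : 1 / 2 <= k < 1 -> 1 - c <= c * k -> x != 1 / 2 ->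
  exists s, [/\ 1 <= s, s < 2 & forall w, state_itv k w ->
    Num.sqrt (digit0 x w) * (Num.sqrt (digit0 x (state0 x w)) + Num.sqrt (digit1 x
      (state0 x w))) +
    Num.sqrt (digit1 x w) * (Num.sqrt (digit0 x (state1 x w)) + Num.sqrt (digit1 x
      (state1 x w))) <= s].
Proof.
move=> k01 hk xn; have /andP[c0 c1] := c_itv x01; rewrite -/c in c0 c1;
  case/andP: (x01) => h0 h1.
case/andP: (k01) => k0 k1.
set ws := (1 - 3 * x) / (2 * x).
pose del := state0 x ws - ws.
have delE : del = - (1 - x) * (1 - 2 * x) / (2 * x) by rewrite /del /state0 /ws; field;
  lra.
have del0 : del != 0.
  by rewrite delE !mulf_neq0 ?oppr_eq0 ?invr_eq0 //; try lra; apply: contra_neq xn; lra.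
have del2 : 0 < del ^+ 2 by rewrite exprn_even_gt0.
pose pm := c * (1 - k).
have pm0 : 0 < pm by rewrite mulr_gt0 //; lra.
have pm1 : pm <= 1 by rewrite /pm; nra.
pose E := (c / 4) ^+ 2 * del ^+ 2.
have E0 : 0 < E by rewrite mulr_gt0 // exprn_gt0 // divr_gt0.
exists (Num.max 1 (2 - pm / 2 * E)); split; first by rewrite le_max lexx.
  by rewrite gt_max; apply/andP; split; [lra|nra].
move=> w hw; rewrite le_max; apply/orP; right.
have hw0 := state_itv0 k01 hw; have hw1 := state_itv1 k01 hk hw.
have s2 : Num.sqrt 2 * Num.sqrt 2 = 2 :> R by rewrite -expr2 sqr_sqrtr.
have s21 : 1 <= Num.sqrt 2 :> R by rewrite -[X in X <= _]sqrtr1 ler_wsqrtr // ler1n.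
have key v : state_itv k v -> Num.sqrt (digit0 x v) + Num.sqrt (digit1 x v) <=
    Num.sqrt 2 * (1 - (digit0 x v - 1 / 2) ^+ 2 / 2).
  by move=> hv; apply: sqrt_sum;
    rewrite ?(ltW (digit0_gt0 k01 hv)) ?(ltW (digit1_gt0 k01 hv)) ?(digit_sum_eq1 k01
      hv).
set A := Num.sqrt (digit0 x w); set B := Num.sqrt (digit1 x w).
have A0 : 0 <= A by exact: sqrtr_ge0.
have B0 : 0 <= B by exact: sqrtr_ge0.
have Apm : pm <= A.
  have /andP[hp hc] := digit0_itv k01 hw; apply: (le_trans hp).
  have h : A ^+ 2 = digit0 x w by rewrite sqr_sqrtr // (ltW (digit0_gt0 k01 hw)).
  by rewrite -/c in hc; nra.
have K := key _ hw; have K0 := key _ hw0; have K1 := key _ hw1.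
rewrite -/A -/B in K.
have wi v : state_itv k v -> -1 < v <= 0 by move=> /andP[? ?]; apply/andP; split=> //;
  lra.
have F := digit0_half (wi _ hw); have F0 := digit0_half (wi _ hw0).
rewrite -/ws in F F0.
set e := (digit0 x w - 1 / 2) ^+ 2 in K F;
  set e0 := (digit0 x (state0 x w) - 1 / 2) ^+ 2 in K0 F0.
have K1' : Num.sqrt (digit0 x (state1 x w)) + Num.sqrt (digit1 x (state1 x w)) <=
  Num.sqrt 2.
  apply: (le_trans K1); rewrite ler_piMr ?sqrtr_ge0 // gerBl divr_ge0 ?sqr_ge0 //.
have e_ge0 : 0 <= e by exact: sqr_ge0.
have e0_ge0 : 0 <= e0 by exact: sqr_ge0.
apply: (@le_trans _ _ (A * (Num.sqrt 2 * (1 - e0 / 2)) + B * Num.sqrt 2)).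
  by rewrite lerD // ler_wpM2l.
apply: (@le_trans _ _ (2 - e - Num.sqrt 2 * A * e0 / 2)).
  have h : Num.sqrt 2 * (A + B) <= Num.sqrt 2 * (Num.sqrt 2 * (1 - e / 2)).
    by rewrite ler_wpM2l // sqrtr_ge0.
  rewrite mulrA s2 in h; nra.
(* either w or state0 w is at distance at least |del| / 2 from ws *)
have dich : E <= e \/ E <= e0.
  have [hc|hc] := lerP (del ^+ 2) (4 * (w - ws) ^+ 2).
    left; apply: le_trans F; rewrite /E !exprMn; have := sqr_ge0 c; nra.
  right; apply: le_trans F0.
  have mE : state0 x w - ws = x * (w - ws) + del by rewrite /del /state0; field.
  have hd : del ^+ 2 <= 4 * (state0 x w - ws) ^+ 2.
    rewrite mE; set v := w - ws in hc *.
    have hv : (2 * `|v|) ^+ 2 < `|del| ^+ 2 by rewrite exprMn !real_normK ?num_real //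
      -natrX.
    have {}hv : 2 * `|v| < `|del| by rewrite ltr_pXn2r // in hv;
      rewrite nnegrE ?mulr_ge0.
    have h3 : `|del| <= 2 * `|x * v + del|.
      have := ler_normB (x * v + del) (x * v); rewrite addrAC subrr add0r.
      rewrite normrM (gtr0_norm h0); have := normr_ge0 v; nra.
    have : `|del| ^+ 2 <= (2 * `|x * v + del|) ^+ 2 by rewrite ler_pXn2r //
      nnegrE ?mulr_ge0.
    by rewrite exprMn !real_normK ?num_real // -natrX.
  rewrite /E !exprMn; have := sqr_ge0 c; nra.
case: dich => hd.
  have : 0 <= Num.sqrt 2 * A * e0 / 2 by apply: divr_ge0 => //; apply: mulr_ge0 => //;
    apply: mulr_ge0 => //; exact: sqrtr_ge0.
  nra.
have : pm * E <= Num.sqrt 2 * A * e0.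
  apply: ler_pM => //; rewrite ?(ltW pm0) ?(ltW E0) //.
  by rewrite -[pm]mul1r ler_pM // ltW.
lra.
Qed.

End Bounds.

(** * Exponential rates *)

(** The growth rate over a single step may be too large at exceptional states; the
factor 2 absorbs the odd last step. *)
Lemma sum_cascade_two_step (R : realType) (t0 t1 : R -> R) (inv : R ->
  Prop) (al be : R -> R) (B : R) :
  (forall w, inv w -> inv (t0 w)) -> (forall w, inv w -> inv (t1 w)) ->
  (forall w, inv w -> 0 <= al w) -> (forall w, inv w -> 0 <= be w) ->
  0 <= B -> (forall w, inv w -> al w + be w <= 2 * B) ->
  (forall w, inv w -> al w * (al (t0 w) + be (t0 w)) + be w * (al (t1 w) + be (t1 w))
    <= B ^+ 2) ->
  forall n w, inv w -> \sum_(0 <= j < 2 ^ n) cascade t0 t1 al be w n j <= 2 * B ^+ n.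
Proof.
move=> i0 i1 a0 b0 B1 h1 h2 n w hw.
suff [] : (forall v, inv v ->
  \sum_(0 <= j < 2 ^ n) cascade t0 t1 al be v n j <= 2 * B ^+ n) /\
  (forall v, inv v -> \sum_(0 <= j < 2 ^ n.+1) cascade t0 t1 al be v n.+1 j <= 2 * B ^+
    n.+1) by move/(_ w hw).
elim: n {w hw} => [|n [IH IHS]]; split => //.
- by move=> v hv; rewrite expn0 big_nat1 expr0 mulr1 ler1n.
- move=> v hv; rewrite sum_cascade expn0 !big_nat1 /= !mulr1 expr1.
  exact: h1.
- move=> v hv; rewrite !sum_cascade.
  set S00 := \sum_(0 <= j < 2 ^ n) cascade _ _ _ _ (t0 (t0 v)) _ _.
  set S01 := \sum_(0 <= j < 2 ^ n) cascade _ _ _ _ (t1 (t0 v)) _ _.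
  set S10 := \sum_(0 <= j < 2 ^ n) cascade _ _ _ _ (t0 (t1 v)) _ _.
  set S11 := \sum_(0 <= j < 2 ^ n) cascade _ _ _ _ (t1 (t1 v)) _ _.
  have v0 := i0 _ hv; have v1 := i1 _ hv.
  apply: (@le_trans _ _ ((al v * (al (t0 v) + be (t0 v)) + be v * (al (t1 v) + be (t1
    v))) * (2 * B ^+ n))).
    rewrite mulrDl lerD // -mulrA ler_wpM2l ?a0 ?b0 // mulrDl lerD //
      ler_wpM2l ?a0 ?b0 // IH //;
      by [exact: i0|exact: i1].
  rewrite [2 * B ^+ n.+2](_ : _ = B ^+ 2 * (2 * B ^+ n)); last by rewrite !exprS; ring.
  by rewrite ler_wpM2r ?h2 // mulr_ge0 // exprn_ge0.
Qed.

(** The function of eta equals 1 at 0, with a negative derivative there; the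
quantitative version uses e^y <= 1 / (1 - y) for y < 1. *)
Lemma exp_rate_lt1 (R : realType) (p A B : R) : 0 <= p <= 1 ->
  p * A + (1 - p) * B < 0 ->
  exists2 eta, 0 < eta & p * expR (eta * A) + (1 - p) * expR (eta * B) < 1.
Proof.
move=> /andP[p0 p1] h; pose D := - (p * A + (1 - p) * B).
have D0 : 0 < D by rewrite /D; lra.
pose S := 1 + `|A| + `|B|.
have S1 : 1 <= S by have := normr_ge0 A; have := normr_ge0 B; rewrite /S; lra.
(* small enough for e |A|, e |B| < 1 and e |A B| < D *)
pose e := Num.min D 1 / S ^+ 2.
have S20 : 0 < S ^+ 2 by rewrite exprn_gt0 // (lt_le_trans ltr01).
have e0 : 0 < e by rewrite divr_gt0 // lt_min D0 ltr01.
have eS : e * S ^+ 2 <= 1 by rewrite divfK ?lt0r_neq0 // ge_min lexx orbT.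
have eD : e * S ^+ 2 <= D by rewrite divfK ?lt0r_neq0 // ge_min lexx.
have AS : `|A| < S by have := normr_ge0 B; rewrite /S; lra.
have BS : `|B| < S by have := normr_ge0 A; rewrite /S; lra.
have SS : S <= S ^+ 2 by rewrite expr2 ler_peMr //; lra.
have lt1 C : `|C| < S -> 0 < 1 - e * C.
  move=> CS; have : e * C <= e * `|C| by rewrite ler_wpM2l ?(ltW e0) // ler_norm.
  have : e * `|C| < e * S by rewrite ltr_pM2l.
  have : e * S <= e * S ^+ 2 by rewrite ler_wpM2l // ltW.
  lra.
have ex C : `|C| < S -> expR (e * C) <= (1 - e * C)^-1.
  move=> CS; rewrite -[expR _]invrK lef_pV2 ?posrE ?invr_gt0 ?expR_gt0 ?lt1 //.
  by rewrite -expRN; have := expR_ge1Dx (- (e * C)); lra.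
exists e => //.
have a0 := lt1 _ AS; have b0 := lt1 _ BS.
apply: (@le_lt_trans _ _ (p * (1 - e * A)^-1 + (1 - p) * (1 - e * B)^-1)).
  by rewrite lerD // ler_wpM2l ?ex ?subr_ge0.
have -> : p * (1 - e * A)^-1 + (1 - p) * (1 - e * B)^-1 =
  (p * (1 - e * B) + (1 - p) * (1 - e * A)) / ((1 - e * A) * (1 - e * B)).
  by field; lra.
rewrite ltr_pdivrMr ?mulr_gt0 // mul1r.
have AB : - (e * S ^+ 2) < e * (A * B).
  rewrite -mulrN ltr_pM2l //; have : `|A * B| < S ^+ 2.
    by rewrite normrM expr2 ltr_pM.
  by rewrite ltr_norml => /andP[].
suff : e * (p * A + (1 - p) * B) < e * (e * (A * B)) by nra.
by rewrite ltr_pM2l //; rewrite /D in eD; lra.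
Qed.

(** Both p and 1 - p are convex combinations of c and 1 - c, with exchanged
weights, and a power with exponent s >= 1 is convex. *)
Lemma powR_pair_le (R : realType) (p c s : R) : 1 <= s -> 0 <= c <= 1 ->
  1 - c <= p <= c ->
  p `^ s + (1 - p) `^ s <= c `^ s + (1 - c) `^ s.
Proof.
move=> s1 /andP[c0 c1] /andP[cp pc].
have [ce|cn] := eqVneq c (1 - c); first by rewrite (_ : p = c); last lra.
have d0 : 0 < c - (1 - c) by rewrite subr_gt0 lt_neqAle eq_sym cn; lra.
pose l := (p - (1 - c)) / (c - (1 - c)).
have l0 : 0 <= l by rewrite divr_ge0 ?(ltW d0) //; lra.
have l1 : l <= 1 by rewrite ler_pdivrMr // mul1r; lra.
have lE : l * (c - (1 - c)) = p - (1 - c) by rewrite divfK // lt0r_neq0.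
have conv (a b t : R) : 0 <= t <= 1 -> 0 <= a -> 0 <= b ->
    (t * a + (1 - t) * b) `^ s <= t * a `^ s + (1 - t) * b `^ s.
  move=> /andP[t0 t1] a0 b0.
  have := @convex_powR R s s1 (Itv01 t0 t1) a b.
  by rewrite !convRE /=; apply; rewrite inE /= in_itv /= andbT.
have h1 := conv c (1 - c) l; have h2 := conv (1 - c) c l.
rewrite l0 l1 c0 subr_ge0 c1 in h1 h2.
have {}h1 := h1 isT isT isT; have {}h2 := h2 isT isT isT.
rewrite (_ : l * c + (1 - l) * (1 - c) = p) in h1; last by nra.
rewrite (_ : l * (1 - c) + (1 - l) * c = 1 - p) in h2; last by nra.
by apply: (le_trans (lerD h1 h2)); rewrite le_eqVlt; apply/orP; left; apply/eqP; ring.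
Qed.

(** * Upper bounds for the dimension of a measure *)

Section Dyadic.
Variable R : realType.
Implicit Types (n j : nat) (t s : R) (U : set R).

Lemma pow2_gt0 n : 0 < 2 ^+ n :> R. Proof. by rewrite exprn_gt0. Qed.

Lemma measurable_dyad n j : measurable (dyad R n j : set (measurableTypeR R)).
Proof. exact: measurable_itv. Qed.

Lemma dyadP n j t : dyad R n j t <-> j%:R <= t * 2 ^+ n <= j.+1%:R.
Proof.
by rewrite /dyad /= in_itv /= ler_pdivrMr ?pow2_gt0 // ler_pdivlMr ?pow2_gt0.
Qed.

Lemma dyad_cover n t : 0 <= t <= 1 -> exists2 j, (j < 2 ^ n)%N & dyad R n j t.
Proof.
move=> /andP[t0 t1]; have tn : 0 <= t * 2 ^+ n by rewrite mulr_ge0 // ltW // pow2_gt0.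
have /andP[h1 h2] := truncn_itv tn.
have [hj|hj] := ltnP (Num.truncn (t * 2 ^+ n)) (2 ^ n)%N.
  by exists (Num.truncn (t * 2 ^+ n)) => //; apply/dyadP; rewrite h1 ltW.
exists (2 ^ n).-1; first by rewrite ltn_predL expn_gt0.
apply/dyadP; rewrite prednK ?expn_gt0 // natrX.
rewrite [X in _ && X](_ : _ = true) ?andbT; last first.
  by rewrite ler_piMl // ltW // pow2_gt0.
apply: le_trans h1; rewrite ler_nat; exact: leq_trans (leq_pred _) hj.
Qed.

Lemma ediam_dyad n j : (ediam (dyad R n j) <= (2 ^- n)%:E)%E.
Proof.
apply: ge_ereal_sup => _ [x /dyadP/andP[x1 x2]] [y /dyadP/andP[y1 y2]] <-.
rewrite lee_fin -[X in _ <= X]mul1r ler_pdivlMr ?pow2_gt0 //.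
rewrite -[X in `|_| * X]gtr0_norm ?pow2_gt0 // -normrM mulrBl ler_norml.
rewrite -natr1 in x2 y2; apply/andP; split; lra.
Qed.

Lemma ediam_ge0 U : U !=set0 -> (0 <= ediam U)%E.
Proof.
move=> [y Uy]; apply: ereal_sup_ubound; exists y => //; exists y => //.
by rewrite subrr normr0.
Qed.

Lemma hgauge_ge0 s U : (0 <= hgauge s U)%E.
Proof. by rewrite /hgauge; case: ifP => // _; exact: poweR_ge0. Qed.

Lemma hgauge_dyad n j s : 0 <= s -> (hgauge s (dyad R n j) <= ((2 ^- n) `^ s)%:E)%E.
Proof.
move=> s0; rewrite /hgauge; case: asboolP => [_|/eqP/set0P ne];
  first by rewrite lee_fin powR_ge0.
rewrite -poweR_EFin; apply: gt0_ler_poweR => //;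
  rewrite ?in_itv /= ?leey ?andbT ?ediam_ge0 //.
exact: ediam_dyad.
Qed.

Lemma hausdorff_content_ge0 s d U : (0 <= hausdorff_content s d U)%E.
Proof.
apply: le_ereal_inf_tmp => _ [V _ <-]; apply: nneseries_ge0 => i _ _.
exact: hgauge_ge0.
Qed.

Lemma hausdorff_measure0 s U :
  (forall d e, 0 < d -> 0 < e -> (hausdorff_content s d U <= e%:E)%E) ->
  hausdorff_measure s U = 0%E.
Proof.
move=> h; apply/eqP; rewrite eq_le; apply/andP; split.
  apply: ge_ereal_sup => _ [d d0 <-]; apply/lee_addgt0Pr => e e0.
  by rewrite add0e; exact: h.
apply: le_trans (hausdorff_content_ge0 s 1 U) _.
by apply: ereal_sup_ubound; exists 1 => //=.
Qed.

Lemma measure_bigsetU_leq (mu : {measure set (measurableTypeR R) -> \bar R})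
    (F : nat -> set (measurableTypeR R)) (a : nat -> R) N (Q : pred nat) :
  (forall j, measurable (F j)) -> (forall j, (j < N)%N -> Q j ->
    (mu (F j) <= (a j)%:E)%E) ->
  (mu (\big[setU/set0]_(0 <= j < N | Q j) F j) <= (\sum_(0 <= j < N | Q j) a j)%:E)%E.
Proof.
move=> mF; rewrite big_mkcond [X in (_ <= X%:E)%E]big_mkcond /=.
elim: N => [|N IH] ha; first by rewrite !big_nil measure0.
rewrite !big_nat_recr //= EFinD; apply: le_trans (measureU2 _ _ _) _.
- by apply: bigsetU_measurable => j _; case: ifP.
- by case: ifP.
- rewrite leeD ?IH // => [j hj|]; first by apply: ha; exact: ltnW.
  by case: ifP => [/ha ->//|_]; rewrite measure0.
Qed.

(** The dyadic interval j of level n gets the number 2^n + j, which turns a cover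
by intervals of all levels into a sequence. *)
Lemma heap_sum (F : nat -> R) k : \sum_(0 <= i < 2 ^ k) F i =
  F 0%N + \sum_(0 <= n < k) \sum_(0 <= j < 2 ^ n) F (2 ^ n + j)%N.
Proof.
elim: k => [|k IH]; first by rewrite expn0 big_nat1 big_geq // addr0.
rewrite expnS mul2n -addnn (big_cat_nat _ (n := (2 ^ k)%N)) ?leq_addr //= IH.
rewrite big_nat_recr //= addrA; congr (_ + _).
rewrite -{1}[(2 ^ k)%N]add0n big_addn addnK; apply: eq_bigr => j _.
by rewrite addnC.
Qed.

End Dyadic.

Lemma geom_tail (R : realType) (y : R) M k : 0 <= y <= 1 ->
  (\sum_(0 <= n < k) if (M <= n)%N then y ^+ n else 0) * (1 - y) <= y ^+ M - y ^+ maxn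
    M k.
Proof.
move=> /andP[y0 y1]; elim: k => [|k IH]; first by rewrite big_geq // maxn0 subrr mul0r.
rewrite big_nat_recr //= mulrDl; case: (leqP M k) => Mk.
  rewrite (maxn_idPr Mk) in IH; rewrite (maxn_idPr (leqW Mk)) exprS; lra.
by rewrite (maxn_idPl (ltnW Mk)) in IH; rewrite (maxn_idPl Mk) mul0r addr0.
Qed.

Section Upper.
Variables (R : realType) (mu : probability (measurableTypeR R) R).
Variables (m psi : nat -> nat -> R) (Lam C rho : R).
Hypotheses (mu01 : mu `[0%R, 1%R]%classic = 1%E).
Hypothesis mu_dyad : forall n j, (j < 2 ^ n)%N -> (mu (dyad R n j) <= (m n j)%:E)%E.
Hypothesis psi_ge0 : forall n j, 0 <= psi n j.
Hypothesis psi_sum : forall n, \sum_(0 <= j < 2 ^ n) psi n j <= Lam ^+ n.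
Hypothesis bad_sum : forall n,
  \sum_(0 <= j < 2 ^ n | psi n j < 1) m n j <= C * rho ^+ n.
Hypotheses (rho01 : 0 <= rho < 1) (Lam1 : 1 <= Lam).

(* The set of full measure that is covered economically: the points that lie in
   an interval with psi >= 1 for infinitely many levels. *)
Let G n : set (measurableTypeR R) :=
  \big[setU/set0]_(0 <= j < 2 ^ n | 1 <= psi n j) dyad R n j.

Let K : set (measurableTypeR R) :=
  `[0%R, 1%R]%classic `&` \bigcap_M \bigcup_(n in [set n | (M <= n)%N]) G n.

Let mG n : measurable (G n).
Proof. by apply: bigsetU_measurable => j _; exact: measurable_dyad. Qed.

Let mK : measurable K.
Proof.
apply: measurableI; first exact: measurable_itv.
by apply: bigcapT_measurable => M; apply: bigcup_measurable.
Qed.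

Let GP n t : G n t <-> exists j, [/\ (j < 2 ^ n)%N, 1 <= psi n j & dyad R n j t].
Proof.
rewrite /G -bigcup_seq_cond; split=> [[j /= /andP[]]|[j [h1 h2 h3]]].
  by rewrite mem_index_iota /= => h1 h2 h3; exists j.
by exists j => //=; rewrite mem_index_iota /= h1.
Qed.

Let mu_bad n : (mu (`[0%R, 1%R]%classic `\` G n) <= (C * rho ^+ n)%:E)%E.
Proof.
apply: (@le_trans _ _ (mu (\big[setU/set0]_(0 <= j < 2 ^ n | psi n j < 1) dyad R n j))).
  apply: le_measure; rewrite ?inE.
  - by apply: measurableD => //; exact: measurable_itv.
  - by apply: bigsetU_measurable => j _; exact: measurable_dyad.
  move=> t [/=]; rewrite in_itv /= => /(@dyad_cover _ n)[j hj hjt] nG.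
  rewrite -bigcup_seq_cond; exists j => //=; rewrite mem_index_iota hj /= ltNge.
  by apply/negP => h; apply: nG; apply/GP; exists j.
apply: le_trans (measure_bigsetU_leq _ _) _.
- by move=> j; exact: measurable_dyad.
- by move=> j hj _; exact: mu_dyad.
- by rewrite lee_fin.
Qed.

Lemma mu_heavy : mu K = 1%E.
Proof.
pose B M : set (measurableTypeR R) :=
  `[0%R, 1%R]%classic `&` \bigcap_(n in [set n | (M <= n)%N]) ~` G n.
have mB M : measurable (B M).
  apply: measurableI; first exact: measurable_itv.
  by apply: bigcap_measurable => [|n _]; [exists M => /=|exact: measurableC].
have B0 M : mu (B M) = 0%E.
  apply/eqP; rewrite eq_le measure_ge0 andbT.
  have c : (C * rho ^+ n)%:E @[n --> \oo] --> (0 : R)%:E.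
    apply: cvg_EFin; first by near=> n.
    rewrite -(mulr0 C); apply: cvgM; first exact: cvg_cst.
    by apply: cvg_expr; case/andP: rho01 => ? ?; rewrite ger0_norm.
  apply: (cvge_to_ge c); near=> n; apply: le_trans (mu_bad n).
  apply: le_measure; rewrite ?inE //.
    by apply: measurableD => //; exact: measurable_itv.
  by move=> t [t01 h]; split=> //; apply: h; near: n; exists M.
have mU : measurable (\bigcup_M B M) by exact: bigcupT_measurable.
have U0 : mu (\bigcup_M B M) = 0%E.
  apply/eqP; rewrite eq_le measure_ge0 andbT.
  apply: (le_trans (measure_sigma_subadditive mu mB mU (@subset_refl _ _))).
  rewrite eseries0 // => i _ _; exact: B0.
apply/eqP; rewrite eq_le probability_le1 //=.
rewrite -mu01 -[X in (_ <= X)%E]adde0 -U0.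
apply: (le_trans _ (measureU2 mu mK mU)).
apply: le_measure; rewrite ?inE; [exact: measurable_itv|exact: measurableU|].
move=> t t01; have [h|/existsNP[M /not_implyP[_ nM]]] := pselect (forall M, True ->
  (\bigcup_(n in [set n | (M <= n)%N]) G n) t).
  by left; split.
by right; exists M => //; split => // n hn /= Gn; apply: nM; exists n.
Unshelve. all: by end_near.
Qed.

(** The intervals with psi >= 1 of all levels n >= M cover K.  There are at most
Lam^n of them at level n, so the sum of the s-th powers of their lengths is at
most the tail from M of the series of (Lam 2^(-s))^n. *)
Lemma dimH_K_le s : ln Lam / ln 2 < s -> (dimH K <= s%:E)%E.
Proof.
move=> hs; have ln2 : 0 < ln 2 :> R by rewrite ln_gt0 // ltr1n.
have Lam0 : 0 < Lam by exact: lt_le_trans Lam1.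
have s0 : 0 <= s by apply: le_trans (ltW hs); rewrite divr_ge0 ?(ltW ln2) // ln_ge0.
have e2 n : (2 ^- n) `^ s = (2 `^ (- s)) ^+ n :> R.
  rewrite -exprVn powRN; rewrite -[in LHS]powR_mulrn ?invr_ge0 // powRAC.
  rewrite powR_mulrn ?powR_ge0 // -[2^-1]powR_inv1 // -powRrM mulN1r powRN //.
pose y := Lam * 2 `^ (- s).
have y0 : 0 < y by rewrite mulr_gt0 // powR_gt0.
have y1 : y < 1.
  rewrite /y powRN ltr_pdivrMr ?powR_gt0 // mul1r.
  by rewrite -[Lam]lnK ?posrE // /powR gt_eqF // ltr_expR -ltr_pdivrMr.
apply: ereal_inf_lbound; exists s => //; split=> //.
apply: hausdorff_measure0 => d e d0 e0.
have [M [M0 Md Me]] : exists M, [/\ (0 < M)%N, 2 ^- M <= d & y ^+ M / (1 - y) <= e].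
  have h1 : \forall n \near \oo, 2 ^- n <= d.
    have : (2^-1 : R) ^+ n @[n --> \oo] --> (0 : R).
      by apply: cvg_expr; rewrite ger0_norm ?invr_ge0 // invf_lt1 // ltr1n.
    move=> /(cvgr_le 0)/(_ d d0); apply: filterS => n; by rewrite exprVn.
  have h2 : \forall n \near \oo, y ^+ n / (1 - y) <= e.
    have : y ^+ n / (1 - y) @[n --> \oo] --> 0 / (1 - y).
      apply: cvgM; last exact: cvg_cst.
      by apply: cvg_expr; rewrite ger0_norm // ltW.
    by rewrite mul0r => /(cvgr_le 0)/(_ e e0).
  near \oo => n; exists n; split; near: n.
  - by exists 1%N.
  - exact: h1.
  - exact: h2.
(* the numbers i >= 2^M run over the intervals of level at least M >= 1; the
   number 0 is never used *)
pose lv i := trunc_log 2 i; pose ix i := (i - 2 ^ lv i)%N.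
pose good i := (2 ^ M <= i)%N && (1 <= psi (lv i) (ix i)).
pose U i : set R := if good i then dyad R (lv i) (ix i) else set0.
apply: (@le_trans _ _ (\sum_(0 <= i <oo) hgauge s (U i))%E).
  apply: ereal_inf_lbound; exists U => //; split.
    move=> t [_ /(_ M I)[n /= Mn /GP[j [jn pj tj]]]].
    have lvE : lv (2 ^ n + j)%N = n.
      by apply: trunc_log_eq => //; rewrite leq_addr expnS mul2n -addnn ltn_add2l jn.
    exists (2 ^ n + j)%N => //; rewrite /U /good /ix lvE addKn pj andbT.
    by rewrite (leq_trans _ (leq_addr _ _)) // leq_exp2l.
  move=> i; rewrite /U; case: ifPn => [/andP[Mi _]|_].
    apply: (le_trans (ediam_dyad _ _ _)); rewrite lee_fin; apply: le_trans Md.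
    rewrite lef_pV2 ?posrE ?pow2_gt0 // ler_weXn2l ?ler1n //.
    by apply: trunc_log_max.
  rewrite /ediam (_ : [set _ | _ in _ & _ in _] = set0) ?ereal_sup0 ?leNye //.
  by apply/seteqP; split => // z [].
pose F i : R := if good i then (2 `^ (- s)) ^+ lv i else 0.
have F0 i : 0 <= F i by rewrite /F; case: ifP => // _; rewrite exprn_ge0 // powR_ge0.
have hF i : (hgauge s (U i) <= (F i)%:E)%E.
  rewrite /U /F; case: ifP => _; first by rewrite -e2; exact: hgauge_dyad.
  by rewrite /hgauge; case: asboolP.
apply: lime_le; first by apply: is_cvg_nneseries => i _ _; exact: hgauge_ge0.
apply: nearW => k; apply: (@le_trans _ _ (\sum_(0 <= i < k) F i)%:E).
  by rewrite -sumEFin; apply: lee_sum => i _; exact: hF.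
rewrite lee_fin; apply: le_trans Me.
apply: (@le_trans _ _ (\sum_(0 <= i < 2 ^ k) F i)).
  rewrite (big_cat_nat _ (n := k) (p := (2 ^ k)%N)) //=;
    last by rewrite ltnW // ltn_expl.
  by rewrite lerDl sumr_ge0.
rewrite heap_sum {1}/F /good ifF ?add0r; last by rewrite leqNgt expn_gt0.
have lev n : \sum_(0 <= j < 2 ^ n) F (2 ^ n + j)%N <= if (M <= n)%N then y ^+ n else 0.
  have lvE j : (j < 2 ^ n)%N -> lv (2 ^ n + j)%N = n.
    by move=> jn; apply: trunc_log_eq => //;
      rewrite leq_addr expnS mul2n -addnn ltn_add2l jn.
  case: ifP => Mn.
    apply: (@le_trans _ _ (\sum_(0 <= j < 2 ^ n) psi n j * (2 `^ (- s)) ^+ n)).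
      rewrite !big_nat; apply: ler_sum => j /andP[_ jn].
      rewrite /F /good /ix lvE // addKn; case: ifP => [/andP[_ pj]|_].
        by rewrite ler_peMl // exprn_ge0 // powR_ge0.
      by rewrite mulr_ge0 // exprn_ge0 // powR_ge0.
    by rewrite -mulr_suml /y exprMn ler_wpM2r // exprn_ge0 // powR_ge0.
  rewrite big_nat big1 // => j /andP[_ jn]; rewrite /F /good ifF //.
  apply/negbTE; rewrite negb_and -ltnNge; apply/orP; left.
  have : (2 ^ n + j < 2 ^ n.+1)%N by rewrite expnS mul2n -addnn ltn_add2l.
  by move=> /leq_trans; apply; rewrite leq_exp2l // ltnNge Mn.
apply: (@le_trans _ _ (\sum_(0 <= n < k) if (M <= n)%N then y ^+ n else 0)).
  by apply: ler_sum => n _.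
rewrite ler_pdivlMr ?subr_gt0 //.
apply: (le_trans (geom_tail M k _)); first by rewrite !ltW.
by rewrite gerBl exprn_ge0 // ltW.
Unshelve. all: by end_near.
Qed.

Lemma dimH_measure_le : (dimH_measure mu <= (ln Lam / ln 2)%:E)%E.
Proof.
apply/lee_addgt0Pr => e e0; rewrite -EFinD; apply: (@le_trans _ _ (dimH K)).
  apply: ereal_inf_lbound; exists K => //; split;
    [exact: mK|by move=> t []|exact: mu_heavy].
by apply: dimH_K_le; rewrite ltrDl.
Qed.

End Upper.

(** * Sets too small to be charged *)

Lemma index_window i j : (i <= j + 2)%N -> (j <= i + 2)%N ->
  exists2 e, (e < 5)%N & (j + e - 2)%N = i.
Proof. by move=> ij ji; exists (i + 2 - j)%N; lia. Qed.

Section Lower.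
Variables (R : realType) (mu : probability (measurableTypeR R) R).
Variables (m : nat -> nat -> R) (Lam rho rho1 : R).
Hypothesis mu_dyad : forall n j, (j < 2 ^ n)%N -> (mu (dyad R n j) <= (m n j)%:E)%E.
Hypothesis m_le : forall n j, (j < 2 ^ n)%N -> m n j <= rho1 ^+ n.
Hypothesis bad_sum :
  forall n, \sum_(0 <= j < 2 ^ n | 1 < m n j * Lam ^+ n) m n j <= rho ^+ n.
Hypotheses (rho01 : 0 <= rho < 1) (rho101 : 0 <= rho1 < 1) (Lam0 : 0 < Lam).

Let bad n j := 1 < m n j * Lam ^+ n.

Let G n : set (measurableTypeR R) :=
  \big[setU/set0]_(0 <= j < 2 ^ n | bad n j) dyad R n j.

Let mG n : measurable (G n).
Proof. by apply: bigsetU_measurable => j _; exact: measurable_dyad. Qed.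

Let mu_G n : (mu (G n) <= (rho ^+ n)%:E)%E.
Proof.
apply: le_trans (measure_bigsetU_leq _ _) _.
- by move=> j; exact: measurable_dyad.
- by move=> j hj _; exact: mu_dyad.
- by rewrite lee_fin; exact: bad_sum.
Qed.

(* The points all of whose dyadic neighbourhoods have mass at most Lam^(-n) from
   level k on. *)
Let A k : set (measurableTypeR R) :=
  `[0%R, 1%R]%classic `&` \bigcap_(n in [set n | (k <= n)%N]) ~` G n.

Let mA k : measurable (A k).
Proof.
apply: measurableI; first exact: measurable_itv.
by apply: bigcap_measurable => [|n _]; [exists k => /=|exact: measurableC].
Qed.

Let A_light k n t : (k <= n)%N -> A k t ->
  exists j, [/\ (j < 2 ^ n)%N, dyad R n j t & ~~ bad n j].
Proof.
move=> kn [/=]; rewrite in_itv /= => /(@dyad_cover _ n)[j hj hjt] nG; exists j;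
  split=> //.
apply/negP => hb; apply: (nG n kn); rewrite /G -bigcup_seq_cond; exists j => //=.
by rewrite mem_index_iota hj.
Qed.

Let mu_point y : 0 <= y <= 1 -> mu [set y] = 0%E.
Proof.
move=> y01; apply/eqP; rewrite eq_le measure_ge0 andbT.
have c : (rho1 ^+ n)%:E @[n --> \oo] --> (0 : R)%:E.
  apply: cvg_EFin; first by near=> n.
  by apply: cvg_expr; case/andP: rho101 => ? ?; rewrite ger0_norm.
apply: (cvge_to_ge c); near=> n.
have [j hj hy] := dyad_cover n y01.
apply: (@le_trans _ _ (mu (dyad R n j))).
  apply: le_measure; rewrite ?inE; [exact: measurable_set1|exact: measurable_dyad|].
  by move=> _ ->.
by apply: (le_trans (mu_dyad hj)); rewrite lee_fin m_le.
Unshelve. all: by end_near.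
Qed.

(** If the diameter of U is comparable to 2^-n, any two dyadic intervals of level
n meeting U have indices differing by at most 2, hence five intervals suffice;
each has mass at most Lam^(-n) <= 2^(-n s). *)
Lemma light_cover s k (U : set R) : 0 <= s -> s * ln 2 <= ln Lam ->
  (ediam U <= (2 ^- k)%:E)%E ->
  exists V : set (measurableTypeR R),
    [/\ measurable V, U `&` A k `<=` V & (mu V <= (5 * 2 `^ s)%:E * hgauge s U)%E].
Proof.
move=> s0 hs hU.
have [/eqP h0|/set0P[y [Uy Ay]]] := boolP (U `&` A k == set0).
  exists set0; split=> //; first by rewrite h0.
  by rewrite measure0 mule_ge0 ?hgauge_ge0 // lee_fin mulr_ge0 // powR_ge0.
have U0 : U !=set0 by exists y.
have d0 := ediam_ge0 U0.
have dfin : ediam U \is a fin_num by rewrite ge0_fin_numE // (le_lt_trans hU) // ltry.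
pose d := fine (ediam U); have dE : ediam U = d%:E by rewrite /d fineK.
have Ud t : U t -> `|t - y| <= d.
  by move=> Ut; rewrite -lee_fin -dE; apply: ereal_sup_ubound; exists t => //; exists y.
have gE : hgauge s U = (d `^ s)%:E.
  rewrite /hgauge; case: asboolP => [e|_]; last by rewrite dE.
  by move: U0; rewrite e => /set0P; rewrite eqxx.
rewrite dE lee_fin in d0 hU; rewrite gE -EFinM.
have y01 : 0 <= y <= 1 by case: Ay => /=; rewrite in_itv.
(* a set of diameter 0 is a point, which is null since the masses tend to 0 *)
have [dz|dn] := eqVneq d 0.
  exists [set y]; split; first exact: measurable_set1.
    move=> t [/Ud + _]; rewrite dz normr_le0 subr_eq0 => /eqP ->; done.
  by rewrite mu_point // lee_fin mulr_ge0 ?powR_ge0 // mulr_ge0 // powR_ge0.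
have dp : 0 < d by rewrite lt_neqAle eq_sym dn.
(* the last level n such that 2^-n is at least the diameter *)
have [n [kn dn1 dn2]] : exists n, [/\ (k <= n)%N, d <= 2 ^- n & 2 ^- n < 2 * d].
  have ex : exists n, d <= 2 ^- n by exists k.
  have bnd n : d <= 2 ^- n -> (n <= Num.truncn d^-1)%N.
    move=> h; rewrite leqNgt; apply/negP => hn.
    have := truncnS_gt d^-1; apply/negP; rewrite -leNgt.
    have h2 : 2 ^+ n <= d^-1 by rewrite -[2 ^+ n]invrK lef_pV2 ?posrE ?invr_gt0
      ?pow2_gt0.
    apply: le_trans h2; rewrite -natrX ler_nat; apply: (leq_trans hn).
    by rewrite ltnW // ltn_expl.
  have [n hn hmax] := ex_maxnP ex bnd; exists n; split => //; first exact: hmax.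
  rewrite ltNge; apply/negP => h; have := hmax n.+1; rewrite ltnn => h'.
  suff : false by []. apply: h'; rewrite exprS invfM.
  by rewrite -ler_pdivrMl ?invrK // invr_gt0.
have [j [jn jy jb]] := A_light kn Ay.
pose V : set (measurableTypeR R) := \big[setU/set0]_(0 <= e < 5 |
  (j + e - 2 < 2 ^ n)%N && ~~ bad n (j + e - 2)) dyad R n (j + e - 2).
exists V; split.
- by apply: bigsetU_measurable => e _; exact: measurable_dyad.
- move=> t [Ut At]; have [i [iN it ib]] := A_light kn At.
  have tyd : `|t - y| * 2 ^+ n <= 1.
    by rewrite -ler_pdivlMr ?pow2_gt0 // mul1r (le_trans (Ud _ Ut)).
  rewrite -[X in _ * X]gtr0_norm ?pow2_gt0 // -normrM mulrBl ler_norml in tyd.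
  move/dyadP: it => /andP[i1 i2]; move/dyadP: jy => /andP[j1 j2].
  case/andP: tyd => h1 h2.
  have ij : (i <= j + 2)%N by rewrite -(ler_nat R) natrD; rewrite -natr1 in i2 j2; lra.
  have ji : (j <= i + 2)%N by rewrite -(ler_nat R) natrD; rewrite -natr1 in i2 j2; lra.
  have [e e5 je] : exists2 e, (e < 5)%N & (j + e - 2)%N = i.
    exact: index_window.
  rewrite /V -bigcup_seq_cond; exists e.
    by rewrite /= mem_index_iota je iN ib e5.
  by rewrite je; apply/dyadP; rewrite i1.
- apply: (@le_trans _ _ (\sum_(0 <= e < 5 |
     (j + e - 2 < 2 ^ n)%N && ~~ bad n (j + e - 2)) Lam ^- n)%:E).
    apply: measure_bigsetU_leq => [e|e _ /andP[h1 h2]]; first exact: measurable_dyad.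
    apply: (le_trans (mu_dyad h1)); rewrite lee_fin.
    by move: h2; rewrite /bad -leNgt -ler_pdivlMr ?exprn_gt0 // mul1r.
  rewrite lee_fin big_mkcond /=.
  have L0 : 0 <= Lam ^- n by rewrite invr_ge0 exprn_ge0 // ltW.
  have Ld : Lam ^- n <= 2 `^ s * d `^ s.
    rewrite -powRM // ?(ltW dp) //.
    apply: (@le_trans _ _ ((2 ^- n) `^ s)); last first.
      by rewrite ge0_ler_powR ?nnegrE ?invr_ge0 ?exprn_ge0 ?mulr_ge0 // ltW.
    rewrite /powR gt_eqF ?invr_gt0 ?pow2_gt0 // lnV ?posrE ?pow2_gt0 // lnXn //.
    rewrite -[Lam ^- n]lnK ?posrE ?invr_gt0 ?exprn_gt0 //
      ler_expR lnV ?posrE ?exprn_gt0 //.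
    rewrite lnXn // mulrN lerN2 mulrnAr.
    by rewrite ler_wMn2r.
  apply: (@le_trans _ _ (\sum_(0 <= e < 5) Lam ^- n)).
    by apply: ler_sum => e _; case: ifP.
  rewrite big_const_nat /= -[X in X <= _](_ : 5 * Lam ^- n = _); last by ring.
  by rewrite -mulrA ler_pM2l.
Qed.

(** Mass distribution principle on each A k; by Borel-Cantelli their complements
in K have arbitrarily small measure. *)
Lemma measure0_dimH_lt (K : set (measurableTypeR R)) : measurable K ->
  K `<=` `[0%R, 1%R]%classic ->
  (dimH K < (ln Lam / ln 2)%:E)%E -> mu K = 0%E.
Proof.
move=> mK K01 hdim; have ln2 : 0 < ln 2 :> R by rewrite ln_gt0 // ltr1n.
have [_ [s [s0 Hs0] <-]] := ereal_inf_lt hdim;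
  rewrite lte_fin ltr_pdivlMr // => /ltW hs.
have KA k : mu (K `&` A k) = 0%E.
  apply/eqP; rewrite eq_le measure_ge0 andbT; apply/lee_addgt0Pr => e e0; rewrite add0e.
  pose c : R := 5 * 2 `^ s; have c0 : 0 < c by rewrite mulr_gt0 // powR_gt0.
  have : (hausdorff_content s (2 ^- k) K < (e / c)%:E)%E.
    apply: (@le_lt_trans _ _ 0%E); last by rewrite lte_fin divr_gt0.
    rewrite -Hs0; apply: ereal_sup_ubound; exists (2 ^- k); last by [].
    by rewrite /= invr_gt0 pow2_gt0.
  move=> /ereal_inf_lt[_ [U [KU hU] <-] hsum].
  have ex i := light_cover s0 hs (hU i).
  have [V hV] := choice ex.
  have mKA : measurable (K `&` A k) by exact: measurableI.
  have sub : K `&` A k `<=` \bigcup_i V i.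
    move=> t [Kt At]; have [i _ Ut] := KU _ Kt; exists i => //.
    by case: (hV i) => _ h _; apply: h.
  have mV i : measurable (V i) by case: (hV i).
  apply: (le_trans (measure_sigma_subadditive mu mV mKA sub)).
  apply: (@le_trans _ _ (\sum_(0 <= i <oo) (c%:E * hgauge s (U i)))%E).
    by apply: lee_nneseries => // i _; case: (hV i).
  rewrite nneseriesZl; last by move=> i _; exact: hgauge_ge0.
  by rewrite muleC -lee_pdivlMr //; exact: ltW.
have U k : (mu K <= (rho ^+ k / (1 - rho))%:E)%E.
  have mB : measurable (\bigcup_(n in [set n | (k <= n)%N]) G n) by exact:
    bigcup_measurable.
  have mKA : measurable (K `&` A k) by exact: measurableI.
  apply: (@le_trans _ _ (mu (K `&` A k `|` \bigcup_(n in [set n | (k <= n)%N]) G n))).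
    apply: le_measure; rewrite ?inE //; first exact: measurableU.
    move=> t Kt; have [h|h] := pselect ((\bigcup_(n in [set n | (k <= n)%N]) G n) t);
      first by right.
    by left; split=> //; split; [exact: K01|move=> n kn Gn; apply: h; exists n].
  apply: (le_trans (measureU2 mu mKA mB)); rewrite [X in (X + _ <= _)%E](KA k) add0e.
  pose F n : set (measurableTypeR R) := if (k <= n)%N then G n else set0.
  have mF n : measurable (F n) by rewrite /F; case: ifP.
  have sub : \bigcup_(n in [set n | (k <= n)%N]) G n `<=` \bigcup_n F n.
    by move=> t [n /= kn Gt]; exists n => //; rewrite /F kn.
  apply: (le_trans (measure_sigma_subadditive mu mF mB sub)).
  apply: lime_le; first by apply: is_cvg_nneseries => i _ _; exact: measure_ge0.
  apply: nearW => l; case/andP: rho01 => r0 r1.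
  apply: (@le_trans _ _ (\sum_(0 <= n < l) if (k <= n)%N then rho ^+ n else 0)%:E).
    rewrite -sumEFin; apply: lee_sum => n _; rewrite /F; case: ifP => _;
      first exact: mu_G.
    by rewrite [X in (X <= _)%E](measure0 mu).
  rewrite lee_fin ler_pdivlMr ?subr_gt0 //.
  apply: (le_trans (geom_tail k l _)); first by rewrite r0 ltW.
  by rewrite gerBl exprn_ge0.
apply/eqP; rewrite eq_le measure_ge0 andbT.
have c : (rho ^+ n / (1 - rho))%:E @[n --> \oo] --> (0 : R)%:E.
  apply: cvg_EFin; first by near=> n.
  rewrite -(mul0r (1 - rho)^-1); apply: cvgM; last exact: cvg_cst.
  by apply: cvg_expr; case/andP: rho01 => ? ?; rewrite ger0_norm.
by apply: (cvge_to_ge c); near=> n; exact: U.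
Unshelve. all: by end_near.
Qed.

End Lower.

(** * The limit law and the theorem *)

Section XuBounds.
Variables (R : realType) (u : R).
Hypothesis hu : 0 < u.

Lemma xu_gt_third : u < Num.sqrt 3 -> 1 / 3 < xu u.
Proof.
move=> h; have u3 : u ^+ 2 < 3.
  by rewrite -[X in _ < X]sqr_sqrtr // ltr_pXn2r ?nnegrE ?sqrtr_ge0 // ltW.
have d := xu_sqrt_gt1 hu; rewrite /xu; set s := Num.sqrt _ in d *.
have s5 : s < 5.
  rewrite -[X in _ < X]gtr0_norm // -sqrtr_sqr ltr_sqrt ?exprn_gt0 //; lra.
by rewrite ltr_pdivlMr; lra.
Qed.

Lemma xu_gt_half : u < 1 -> 1 / 2 < xu u.
Proof.
move=> h; have u1 : u ^+ 2 < 1 by rewrite expr_lt1 // ltW.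
have d := xu_sqrt_gt1 hu; rewrite /xu; set s := Num.sqrt _ in d *.
have s3 : s < 3.
  rewrite -[X in _ < X]gtr0_norm // -sqrtr_sqr ltr_sqrt ?exprn_gt0 //; lra.
by rewrite ltr_pdivlMr; lra.
Qed.

Lemma xu_neq_half : u != 1 -> xu u != 1 / 2.
Proof.
apply: contra_neq => h; have := xu_eq hu; rewrite h => e.
have e1 : u ^+ 2 = 1 by lra.
by apply/eqP; rewrite -(eqrXn2 (n := 2)) ?e1 ?expr1n // ltW.
Qed.

End XuBounds.

Lemma powR_one (R : realType) (s : R) : 1 `^ s = 1.
Proof. by rewrite powR1. Qed.

(** The exponent -1/2 in the Chernoff bound turns sums of masses into sums of
square roots of masses. *)
Lemma half_power (R : realType) (p th : R) : 0 < p -> 0 < th ->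
  p * (p / th) `^ (- (1 / 2)) = Num.sqrt p * Num.sqrt th.
Proof.
move=> p0 th0; rewrite powRN; set z := (p / th) `^ (1 / 2).
have z0 : 0 < z by rewrite powR_gt0 // divr_gt0.
have z2 : z ^+ 2 = p / th.
  rewrite -powR_mulrn ?ltW // -powRrM mul1r mulVf ?powRr1 ?pnatr_eq0 //.
  by rewrite ltW // divr_gt0.
have pE : p = th * z ^+ 2 by rewrite z2 mulrC divfK // lt0r_neq0.
rewrite -sqrtrM ?(ltW p0) // {2}pE (_ : th * z ^+ 2 * th = (th * z) ^+ 2); last by ring.
rewrite sqrtr_sqr gtr0_norm ?mulr_gt0 // {1}pE; field; lra.
Qed.

Lemma half_itv (R : realType) : 1 / 2 <= (1 / 2 : R) < 1.
Proof. by apply/andP; split; lra. Qed.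

Section Mass.
Variables (R : realType) (x : R).
Hypothesis x01 : 0 < x < 1.
Let c := 2 * x / (1 + x).

Definition dyad_mass n j : R :=
  cascade (state0 x) (state1 x) (digit0 x) (digit1 x) 0 n j.

(** Here psi is the mass divided by th^n.  With s < 2 the two-step bound of
[two_step_sqrt_sum], any th in ]1/2, 1/s[ works. *)
Lemma dyad_mass_entropy_gap : 1 / 3 < x -> x != 1 / 2 ->
  exists th C rho, [/\ 1 / 2 < th < 1, 0 <= rho < 1 &
    let psi n j := cascade (state0 x) (state1 x) (fun w => digit0 x w / th) (fun w =>
      digit1 x w / th) 0 n j in
    [/\ forall n j, 0 <= psi n j,
        forall n, \sum_(0 <= j < 2 ^ n) psi n j <= th^-1 ^+ n &
        forall n, \sum_(0 <= j < 2 ^ n | psi n j < 1) dyad_mass n j <= C * rho ^+ n]].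
Proof.
move=> x3 xn; have [k [k01 hk]] := kappa_exists x01 x3.
have [s [s1 s2 hs]] := two_step_sqrt_sum x01 k01 hk xn.
have s0 : 0 < s by exact: lt_le_trans s1.
pose th := (1 / 2 + s^-1) / 2.
have si : 1 / 2 < s^-1 by rewrite -[1 / 2]invrK ltf_pV2 ?posrE ?divr_gt0 // div1r invrK.
have si1 : s^-1 <= 1 by rewrite invf_le1.
have thb : 1 / 2 < th < s^-1 by rewrite /th; apply/andP; split; lra.
have /andP[th1 th2] := thb; have th0 : 0 < th by lra.
have sth : s * th < 1 by rewrite mulrC -ltr_pdivlMr // div1r.
pose B := Num.sqrt s * Num.sqrt th.
have B0 : 0 <= B by rewrite mulr_ge0 ?sqrtr_ge0.
have B2 : B ^+ 2 = s * th by rewrite exprMn !sqr_sqrtr // ltW.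
exists th, 2, B; split.
- by rewrite th1 /=; lra.
- by rewrite B0 /= -(@expr_lt1 _ 2) // B2.
have i0 w : state_itv k w -> state_itv k (state0 x w) by apply: state_itv0.
have i1 w : state_itv k w -> state_itv k (state1 x w) by apply: state_itv1.
have a0 w : state_itv k w -> 0 < digit0 x w / th by move=> hw;
  rewrite divr_gt0 // (digit0_gt0 x01 k01).
have b0 w : state_itv k w -> 0 < digit1 x w / th by move=> hw;
  rewrite divr_gt0 // (digit1_gt0 x01 k01).
have w0 := state_itv_0 k01.
move=> psi; split.
- by move=> n j; apply: ltW; apply: (cascade_gt0 i0 i1).
- move=> n; rewrite /psi; apply: (sum_cascade_le i0 i1) => // w hw;
    try exact: ltW (a0 _ hw); try exact: ltW (b0 _ hw).
  by rewrite -mulrDl (digit_sum_eq1 x01 k01) // mul1r.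
move=> n; apply: le_trans (cascade_chernoff i0 i1 (s := - (1 / 2)) _ _ a0 b0 w0 _) _.
- by move=> w; exact: digit0_gt0.
- by move=> w; exact: digit1_gt0.
- move=> j hj; rewrite -/(psi n j); have h : 0 < psi n j by exact: (cascade_gt0 i0 i1).
  rewrite powRN invf_ge1 ?powR_gt0 // -[X in _ <= X](powR_one (1 / 2)).
  by rewrite ge0_ler_powR ?nnegrE ?ltW.
have hp w : state_itv k w ->
  digit0 x w * (digit0 x w / th) `^ (- (1 / 2)) = Num.sqrt (digit0 x w) * Num.sqrt th.
  by move=> hw; rewrite half_power // (digit0_gt0 x01 k01).
have hq w : state_itv k w ->
  digit1 x w * (digit1 x w / th) `^ (- (1 / 2)) = Num.sqrt (digit1 x w) * Num.sqrt th.
  by move=> hw; rewrite half_power // (digit1_gt0 x01 k01).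
apply: (@sum_cascade_two_step _ _ _ (state_itv k)) => // w hw.
- by rewrite hp // mulr_ge0 ?sqrtr_ge0.
- by rewrite hq // mulr_ge0 ?sqrtr_ge0.
- rewrite hp // hq // -mulrDl /B mulrA ler_wpM2r ?sqrtr_ge0 //.
  have := sqrt_sum (ltW (digit0_gt0 x01 k01 hw)) (ltW (digit1_gt0 x01 k01 hw))
    (digit_sum_eq1 x01 k01 hw).
  have ss : 1 <= Num.sqrt s by rewrite -[X in X <= _]sqrtr1 ler_wsqrtr.
  have s22 : Num.sqrt 2 <= 2 :> R.
    by rewrite -[X in _ <= X]gtr0_norm // -sqrtr_sqr ler_wsqrtr // expr2 ler_peMr //
      ler1n.
  have := sqrtr_ge0 (2 : R); have := sqr_ge0 (digit0 x w - 1 / 2); nra.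
- have hw0 := i0 _ hw; have hw1 := i1 _ hw.
  rewrite !hp // !hq // B2.
  apply: le_trans (ler_wpM2r (ltW th0) (hs _ hw)).
  have st : Num.sqrt th * Num.sqrt th = th by rewrite -expr2 sqr_sqrtr // ltW.
  by rewrite le_eqVlt; apply/orP; left; apply/eqP; rewrite -[X in _ = _ * X]st; ring.
Qed.

Hypothesis xh : 1 / 2 < x.

Let hk : 1 - c <= c * (1 / 2).
Proof.
have h : 2 / 3 <= c by case/andP: x01 => h0 h1; have x2 := xh; rewrite /c ler_pdivlMr;
  lra.
lra.
Qed.

(** Equality holds at w = -1/2, the lowest state. *)
Lemma digit1_le w : state_itv (1 / 2) w -> digit1 x w <= 1 - x.
Proof.
move=> hw; have [/andP[d1 d2] _] := den_bound x01 (half_itv R) hw.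
have ce := c_eq x01; have /andP[c0 c1] := c_itv x01; rewrite -/c in ce c0 c1 d1 d2.
case/andP: hw => w1 w0; case/andP: x01 => h0 h1.
rewrite /digit1 -/c ler_pdivrMr; last exact: lt_le_trans d2.
apply: (@le_trans _ _ ((1 - x) * (1 - c * (1 / 2)))); last by rewrite ler_wpM2l //; lra.
nra.
Qed.

Let i0 w : state_itv (1 / 2) w ->
  state_itv (1 / 2) (state0 x w). Proof. exact: (state_itv0 x01 (half_itv R)). Qed.
Let i1 w : state_itv (1 / 2) w ->
  state_itv (1 / 2) (state1 x w). Proof. exact: (state_itv1 x01 (half_itv R) hk). Qed.
Let w0 : state_itv (1 / 2 : R) 0. Proof. exact: (state_itv_0 (half_itv R)). Qed.

(** Comparison with the Bernoulli measure of parameter x: the weight of the digit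
1 to the power -eta is the larger one, so the conditional sum increases with
the probability of the digit 1, which is at most 1 - x. *)
Lemma dyad_mass_rate_upper a : entropy x < a -> exists2 rho, 0 <= rho < 1 &
  let psi n j := cascade (state0 x) (state1 x) (fun=> x * expR a) (fun=> (1 - x) * expR
    a) 0 n j in
  [/\ forall n j, 0 <= psi n j,
      forall n, \sum_(0 <= j < 2 ^ n) psi n j <= expR a ^+ n &
      forall n, \sum_(0 <= j < 2 ^ n | psi n j < 1) dyad_mass n j <= 1 * rho ^+ n].
Proof.
move=> ha; case/andP: (x01) => h0 h1; have x1 : 0 < 1 - x by lra.
have [||eta e0 he] := @exp_rate_lt1 R x (- ln x - a) (- ln (1 - x) - a).
- by apply/andP; split; lra.
- by move: ha; rewrite /entropy; lra.
have pw y : 0 < y -> (y * expR a) `^ (- eta) = expR (eta * (- ln y - a)).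
  move=> y0; rewrite /powR gt_eqF ?mulr_gt0 ?expR_gt0 // lnM ?posrE ?expR_gt0 // expRK.
  by congr expR; ring.
exists (x * expR (eta * (- ln x - a)) + (1 - x) * expR (eta * (- ln (1 - x) - a))).
  by rewrite he andbT addr_ge0 // mulr_ge0 ?expR_ge0 // ltW.
have a0 (w : R) : state_itv (1 / 2) w -> 0 < x * expR a by rewrite mulr_gt0 ?expR_gt0.
have b0 (w : R) : state_itv (1 / 2) w ->
  0 < (1 - x) * expR a by rewrite mulr_gt0 ?expR_gt0.
have psi_gt0 n j : 0 < cascade (state0 x) (state1 x) (fun=> x * expR a) (fun=> (1 - x)
  * expR a) 0 n j.
  exact: (@cascade_gt0 _ _ _ _ i0 i1 (fun=> x * expR a) (fun=> (1 - x) * expR a) 0 n j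
    a0 b0 w0).
move=> psi; split.
- by move=> n j; apply: ltW.
- move=> n; rewrite /psi; apply: (sum_cascade_le i0 i1) => // w hw;
    try exact: ltW (a0 _ hw); try exact: ltW (b0 _ hw).
  by rewrite -mulrDl (_ : x + (1 - x) = 1) ?mul1r //; ring.
move=> n; rewrite mul1r;
  apply: le_trans (cascade_chernoff i0 i1 (s := - eta) _ _ a0 b0 w0 _) _.
- by move=> w; exact: (digit0_gt0 x01 (half_itv R)).
- by move=> w; exact: (digit1_gt0 x01 (half_itv R)).
- move=> j hj; rewrite -/(psi n j); have h : 0 < psi n j by exact: psi_gt0.
  rewrite powRN invf_ge1 ?powR_gt0 // -[X in _ <= X](powR_one eta).
  by rewrite ge0_ler_powR ?nnegrE ?ltW.
apply: (sum_cascade_le i0 i1) => // w hw.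
- by rewrite mulr_ge0 ?powR_ge0 // ltW // (digit0_gt0 x01 (half_itv R)).
- by rewrite mulr_ge0 ?powR_ge0 // ltW // (digit1_gt0 x01 (half_itv R)).
rewrite !pw //; set U := expR _; set V := expR _.
have UV : U <= V.
  have x2 := xh; by rewrite ler_expR ler_pM2l // lerD2r lerN2 ler_ln ?posrE //; lra.
have ps := digit_sum_eq1 x01 (half_itv R) hw; have p1l := digit1_le hw.
rewrite (_ : digit0 x w = 1 - digit1 x w); last by lra.
nra.
Qed.

(** Here the mass is compared with itself; the conditional sum of the powers
1 + eta is maximal when the digit 0 has probability c. *)
Lemma dyad_mass_rate_lower a : a < entropy c -> exists2 rho, 0 <= rho < 1 &
  forall n, \sum_(0 <= j < 2 ^ n | 1 < dyad_mass n j * expR a ^+ n) dyad_mass n j <=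
    rho ^+ n.
Proof.
move=> ha; have /andP[c0 c1] := c_itv x01; rewrite -/c in c0 c1.
have c1' : 0 < 1 - c by lra.
have [||eta e0 he] := @exp_rate_lt1 R c (ln c + a) (ln (1 - c) + a).
- by apply/andP; split; lra.
- by move: ha; rewrite /entropy; lra.
have pD y : 0 < y -> y `^ (1 + eta) = y * y `^ eta.
  move=> y0; rewrite powRD ?powRr1 ?(ltW y0) //; apply/implyP => _.
  by rewrite gt_eqF.
have pw y : 0 < y -> y * (y * expR a) `^ eta = y `^ (1 + eta) * expR (eta * a).
  move=> y0; rewrite powRM ?expR_ge0 // ?ltW // mulrA; congr (_ * _).
    exact/esym/pD.
  by rewrite -expRM mulrC.
have pe y : 0 < y -> y `^ (1 + eta) * expR (eta * a) = y * expR (eta * (ln y + a)).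
  move=> y0; rewrite pD //.
  by rewrite mulrDr expRD mulrA /powR gt_eqF.
exists (c * expR (eta * (ln c + a)) + (1 - c) * expR (eta * (ln (1 - c) + a))).
  by rewrite he andbT addr_ge0 // mulr_ge0 ?expR_ge0 // ltW.
have a0 w : state_itv (1 / 2) w -> 0 < digit0 x w * expR a.
  by move=> hw; rewrite mulr_gt0 ?expR_gt0 // (digit0_gt0 x01 (half_itv R)).
have b0 w : state_itv (1 / 2) w -> 0 < digit1 x w * expR a.
  by move=> hw; rewrite mulr_gt0 ?expR_gt0 // (digit1_gt0 x01 (half_itv R)).
move=> n; apply: le_trans (cascade_chernoff i0 i1 (s := eta) _ _ a0 b0 w0 _) _.
- by move=> w; exact: (digit0_gt0 x01 (half_itv R)).
- by move=> w; exact: (digit1_gt0 x01 (half_itv R)).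
- move=> j hj; rewrite cascade_scale -/(dyad_mass n j) -[X in X <= _](powR_one eta).
  by rewrite ge0_ler_powR ?nnegrE ?(ltW e0) ?(ltW hj) // ltW // (lt_trans ltr01).
apply: (sum_cascade_le i0 i1) => // w hw.
- by rewrite mulr_ge0 ?powR_ge0 // ltW // (digit0_gt0 x01 (half_itv R)).
- by rewrite mulr_ge0 ?powR_ge0 // ltW // (digit1_gt0 x01 (half_itv R)).
have q0 := digit0_gt0 x01 (half_itv R) hw; have q1 := digit1_gt0 x01 (half_itv R) hw.
rewrite !pw // -!pe // -!mulrDl ler_wpM2r ?expR_ge0 //.
have ps := digit_sum_eq1 x01 (half_itv R) hw; have p1l := digit1_le hw.
have /andP[_ pc] := digit0_itv x01 (half_itv R) hw; rewrite -/c in pc.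
rewrite (_ : digit1 x w = 1 - digit0 x w); last by lra.
apply: powR_pair_le; rewrite ?lerDl ?(ltW e0) ?(ltW c0) ?(ltW c1) //.
rewrite pc andbT.
have xc : x <= c by have := c_eq x01; rewrite -/c; case/andP: x01 => ? ?; nra.
have x2 := xh; lra.
Qed.

End Mass.

Section MassLimit.
Variables (R : realType) (u : R).
Variables (P : probability Winf_mt R) (Pt : probability (measurableTypeR R) R).
Hypotheses (hu : 0 < u) (hP : is_Pu u P) (hPt : converges_weakly P (@Xn R) Pt).

(** The margins on both sides of the dyadic interval have mass at most rho^M
each. *)
Lemma limit_dyad_mass n j : 1 / 3 < xu u -> (j < 2 ^ n)%N ->
  (Pt (dyad R n j) <= (dyad_mass (xu u) n j)%:E)%E.
Proof.
move=> x3 hj; have x01 : 0 < xu u < 1 by rewrite xu_gt0 // xu_lt1.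
have [k [k01 hk]] := kappa_exists x01 x3.
set rho := Num.max (2 * xu u / (1 + xu u)) (1 - 2 * xu u / (1 + xu u) * (1 - k)).
have /andP[r0 r1] : 0 < rho < 1 := contraction_itv x01 k01.
have h M : (0 < M)%N -> (Pt (dyad R n j) <= (dyad_mass (xu u) n j + 2 * rho ^+ M)%:E)%E.
  move=> M0; apply: (le_trans (limit_dyad_le hu hP hPt j (_ : (0 < n + M)%N)));
    first by rewrite addn_gt0 M0 orbT.
  rewrite lee_fin /dyad_mass -(range_cdf_step x01 hj) -(range_cdf_scale x01 n M j.+1)
    -(range_cdf_scale x01 n M j).
  have st i : range_cdf (xu u) (n + M) i.+1 - range_cdf (xu u) (n + M) i <= rho ^+ M.
    apply: (le_trans (range_cdf_step_le x01 k01 hk _ _)).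
    by rewrite exprD ler_piMl ?exprn_ge0 ?(ltW r0) // exprn_ile1 ?ltW.
  have s1 := st (j.+1 * 2 ^ M)%N.
  have s2 : range_cdf (xu u) (n + M) (j * 2 ^ M) - range_cdf (xu u) (n + M) (j * 2 ^
    M).-1 <= rho ^+ M.
    case: (j * 2 ^ M)%N => [|i]; last exact: st.
    by rewrite subrr exprn_ge0 // ltW.
  by move: s1 s2; lra.
have c : (dyad_mass (xu u) n j + 2 * rho ^+ M)%:E @[M --> \oo] --> (dyad_mass (xu u) n
  j)%:E.
  apply: cvg_EFin; first by near=> M.
  rewrite -[X in _ --> X]addr0 -[X in _ --> _ + X](mulr0 2).
  apply: cvgD; first exact: cvg_cst.
  apply: cvgM; first exact: cvg_cst.
  by apply: cvg_expr; rewrite gtr0_norm.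
apply: (cvge_to_ge c); near=> M; apply: h; near: M; by exists 1%N.
Unshelve. all: by end_near.
Qed.

End MassLimit.

Theorem theorem1p3 (R : realType) (u : R)
    (P : probability Winf_mt R) (Pt : probability (measurableTypeR R) R)
    (hP : is_Pu u P)
    (hPt01 : Pt `[0%R, 1%R]%classic = 1%E)
    (hPt : converges_weakly P (@Xn R) Pt) :
  (u != 1 -> 0 < u < Num.sqrt 3 -> (dimH_measure Pt < 1)%E) /\
  (0 < u < 1 ->
     (dimH_measure Pt <= (entropy (xu u) / ln 2)%:E)%E /\
     (forall K : set (measurableTypeR R),
        measurable K -> K `<=` `[0%R, 1%R]%classic ->
        (dimH K < (entropy (2 * xu u / (1 + xu u)) / ln 2)%:E)%E ->
        Pt K = 0%E)).
Proof.
have ln2 : 0 < ln 2 :> R by rewrite ln_gt0 // ltr1n.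
split=> [u1 /andP[u0 u3]|/andP[u0 u1]].
  have x01 : 0 < xu u < 1 by rewrite xu_gt0 // xu_lt1.
  have x3 := xu_gt_third u0 u3.
  have [th [C [rho [/andP[t1 t2] r01 [psi0 psiS bad]]]]] :=
    dyad_mass_entropy_gap x01 x3 (xu_neq_half u0 u1).
  have th0 : 0 < th by lra.
  have L1 : 1 <= th^-1 by rewrite invf_ge1 // ltW.
  apply: (le_lt_trans (dimH_measure_le hPt01 (fun n j =>
    limit_dyad_mass u0 hP hPt x3) psi0 psiS bad r01 L1)).
  rewrite lte_fin ltr_pdivrMr // mul1r ltr_ln ?posrE ?invr_gt0 //.
  by rewrite invf_plt ?posrE //; lra.
have x01 : 0 < xu u < 1 by rewrite xu_gt0 // xu_lt1.
have xh := xu_gt_half u0 u1.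
have x3 : 1 / 3 < xu u by lra.
split.
  apply/lee_addgt0Pr => e e0; rewrite -EFinD.
  pose a := entropy (xu u) + e * ln 2.
  have ea : entropy (xu u) < a by rewrite ltrDl mulr_gt0.
  have [rho r01 [psi0 psiS bad]] := dyad_mass_rate_upper x01 xh ea.
  have ent0 : 0 <= entropy (xu u).
    have l1 : ln (xu u) <= 0 by apply: ln_le0; case/andP: x01 => ? ?; lra.
    have l2 : ln (1 - xu u) <= 0 by apply: ln_le0; case/andP: x01 => ? ?; lra.
    by rewrite /entropy; case/andP: x01 => ? ?; nra.
  have L1 : 1 <= expR a by rewrite -expR0 ler_expR ltW // (le_lt_trans ent0).
  apply: (le_trans (dimH_measure_le hPt01 (fun n j =>
    limit_dyad_mass u0 hP hPt x3) psi0 psiS bad r01 L1)).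
  by rewrite expRK lee_fin /a mulrDl mulfK // lt0r_neq0.
move=> K mK K01 hdim.
have [_ [s [s0 Hs] <-]] := ereal_inf_lt hdim; rewrite lte_fin ltr_pdivlMr // => hs.
set E := entropy _ in hdim hs.
pose a := (s * ln 2 + E) / 2.
have aE : a < E by rewrite /a; lra.
have [rho r01 bad] := dyad_mass_rate_lower x01 xh aE.
have [k [k01 hk]] := kappa_exists x01 x3.
have /andP[r0 r1] := contraction_itv x01 k01.
apply: (measure0_dimH_lt (fun n j =>
  limit_dyad_mass u0 hP hPt x3) _ bad r01 _ (expR_gt0 a) mK K01).
- by move=> n j _; apply: (cascade_digit_le x01 k01 hk); exact: state_itv_0.
- by rewrite ltW.
- rewrite expRK; apply: (@le_lt_trans _ _ s%:E).
    by apply: ereal_inf_lbound; exists s.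
  by rewrite lte_fin ltr_pdivlMr // /a; lra.
Qed.
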